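(* Let $X$ be a compact Hausdorff space and let $\mathcal{P}$ and $\mathcal{Q}$ be topological operads equipped with realization systems $\mathcal{R}\mathcal{P}$ and $\mathcal{R}\mathcal{Q}$, both with boundaries $X$. Then the collection $\mathcal{M}=\{\mathcal{M}(n)\}_{n\geq0}$ (the mapping operad) is a topological operad, and the projections $\mathcal{P}\leftarrow\mathcal{M}\rightarrow\mathcal{Q}$, $(a,c,f)\mapsto a$ and $(a,c,f)\mapsto c$, are morphisms of operads.
   Context: Operads are symmetric topological operads $\mathcal{O}=\{\mathcal{O}(n)\}_{n\geq0}$ (with $\mathcal{O}(0)$ arbitrary), right $\Sigma_n$-actions, unit $\mathbf{1}_{\mathcal{O}}$ and composition $\gamma(x;y_1,\ldots,y_n)$. Underlines denote tuples. Realization systems. Let $X$ be compact Hausdorff. A realization system $\mathcal{R}\mathcal{O}$ for $\mathcal{O}$ with boundaries $X$ assigns to each $x\in\mathcal{O}(n)$ a space $|x|$, together with: incoming boundary maps $\partial_1,\ldots,\partial_n\colon X\to|x|$ and an outgoing boundary map $\partial_{\mathrm{out}}\colon X\to|x|$; for each $\sigma\in\Sigma_n$ a symmetry map $\sigma^*\colon|x|\to|x\sigma|$; and for $x\in\mathcal{O}(n)$, $y_i\in\mathcal{O}(m_i)$, pasting maps $\lambda\colon|x|\to|\gamma(x;\underline y)|$ and $\mu=(\mu_i)\colon\bigsqcup_i|y_i|\to|\gamma(x;\underline y)|$ such that the ''pasting square'' with top $\bigsqcup\partial_{\mathrm{out}}\colon\bigsqcup_{i=1}^nX\to\bigsqcup_i|y_i|$,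 left side $\bigsqcup\partial_i\colon\bigsqcup_{i=1}^nX\to|x|$, bottom $\lambda$ and right side $\mu$ is a pushout. Axioms: 1. (Unit) $\partial_1=\partial_{\mathrm{out}}\colon X\to|\mathbf{1}_{\mathcal{O}}|$ is a homeomorphism. For $\gamma(\mathbf{1};y)=y$: $\mu=\mathrm{Id}_{|y|}$ and $\lambda\circ\partial_1=\partial_{\mathrm{out}}$. For $\gamma(x;\mathbf{1},\ldots,\mathbf{1})=x$: $\lambda=\mathrm{Id}_{|x|}$ and $\mu_i\circ\partial_{\mathrm{out}}=\partial_i$. 2. (Symmetries) $\sigma^*\circ\tau^*=(\tau\sigma)^*$, $\sigma^*\circ\partial_i=\partial_{\sigma^{-1}i}$, $\sigma^*\circ\partial_{\mathrm{out}}=\partial_{\mathrm{out}}$. 3. (Pasting and boundaries) $\lambda\circ\partial_{\mathrm{out}}=\partial_{\mathrm{out}}$ and $\mu_i\circ\partial_j=\partial_{m_1+\cdots+m_{i-1}+j}$. 4. (Pasting and symmetries I) For $\sigma_i\in\Sigma_{m_i}$, with $\lambda,\mu$ the pasting maps of $(x;y_1,\ldots,y_n)$ and $\lambda',\mu'$ those of $(x;y_1\sigma_1,\ldots,y_n\sigma_n)$: $(\sigma_1\oplus\cdots\oplus\sigma_n)^*\circ\lambda=\lambda'$ and $(\sigma_1\oplus\cdots\oplus\sigma_n)^*\circ\mu_i=\mu_i'\circ\sigma_i^*$. 5. (Pasting and symmetries II) For $\sigma\in\Sigma_n$, with $\lambda,\mu$ the pasting maps of $(x;y_{\sigma^{-1}(1)},\ldots,y_{\sigma^{-1}(n)})$,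 $\lambda',\mu'$ those of $(x\sigma;y_1,\ldots,y_n)$, and $\sigma(m_1,\ldots,m_n)$ the block permutation with $\gamma(x;y_{\sigma^{-1}(1)},\ldots,y_{\sigma^{-1}(n)})\,\sigma(m_1,\ldots,m_n)=\gamma(x\sigma;y_1,\ldots,y_n)$: $\sigma(m_1,\ldots,m_n)^*\circ\lambda=\lambda'\circ\sigma^*$ and $\sigma(m_1,\ldots,m_n)^*\circ\mu_{\sigma(i)}=\mu'_i$ on $|y_i|$. 6. (Associativity) For $x\in\mathcal{O}(n)$, $y_i\in\mathcal{O}(m_i)$, $z_i^j\in\mathcal{O}(l_i^j)$, write $\Gamma=\gamma(\gamma(x;\underline y);\underline z)=\gamma(x;\gamma(y_1;\underline{z_1}),\ldots,\gamma(y_n;\underline{z_n}))$. The two maps into $|\Gamma|$ built from pasting maps via the two ways of forming $\Gamma$ coincide, on each of $|x|$, $|y_i|$, $|z_i^j|$. Topology: fibred spaces $\rho_n\colon\mathcal{R}\mathcal{O}(n)\to\mathcal{O}(n)$ are given with $\rho_n^{-1}(x)$ identified with $|x|$, each fibrewise compact ($\rho_n$ closed with compact fibres) and fibrewise Hausdorff (distinct points of a fibre have disjoint open neighbourhoods in $\mathcal{R}\mathcal{O}(n)$). The functions $\partial_1,\ldots,\partial_n,\partial_{\mathrm{out}}\colon\mathcal{O}(n)\times X\to\mathcal{R}\mathcal{O}(n)$, $\sigma^*$ (from $\mathcal{R}\mathcal{O}(n)$ to its pullback along $\sigma\colon\mathcal{O}(n)\to\mathcal{O}(n)$), and the maps $\lambda,\mu$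 between spaces over $\mathcal{O}(n)\times\mathcal{O}(m_1)\times\cdots\times\mathcal{O}(m_n)$ (obtained by pulling back $\mathcal{R}\mathcal{O}(n)$, $\mathcal{R}\mathcal{O}(m_i)$ along projections and $\mathcal{R}\mathcal{O}(m_1+\cdots+m_n)$ along composition) are continuous, and the resulting squares of pasting maps over this product are fibrewise pushouts (i.e. pushouts of spaces, over the base). The mapping operad. $\mathcal{M}(n)$ is the set of triples $(a,c,f)$ with $a\in\mathcal{P}(n)$, $c\in\mathcal{Q}(n)$, $f\colon|a|\to|c|$ continuous with $f\circ\partial_i=\partial_i$ for $1\leq i\leq n$ and $f\circ\partial_{\mathrm{out}}=\partial_{\mathrm{out}}$. It is a subspace of $\mathrm{Map}_B(\pi_1^*\mathcal{R}\mathcal{P}(n),\pi_2^*\mathcal{R}\mathcal{Q}(n))$, $B=\mathcal{P}(n)\times\mathcal{Q}(n)$ with projections $\pi_1,\pi_2$. Here, for $U,V$ fibred over $B$, $\mathrm{Map}_B(U,V)$ is the set of pairs $(b,f)$ with $b\in B$, $f\colon U_b\to V_b$ continuous, with topology generated by the sets $\{(b,f):b\in W,\ f(K_b)\subset O_b\}$, $W\subset B$ open, $K\subset U|_W$ fibrewise compact over $W$, $O\subset V|_W$ open. Action: $(a,c,f)\sigma=(a\sigma,c\sigma,\sigma^*\circ f\circ(\sigma^* )^{-1})$. Unit: $(\mathbf{1}_{\mathcal{P}},\mathbf{1}_{\mathcal{Q}},f)$ with $f\circ\partial_{\mathrm{out}}=\partial_{\mathrm{out}}$. Composition: $\gamma((a,c,f);(b_1,d_1,g_1),\ldots,(b_n,d_n,g_n))=(\gamma(a;\underline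 b),\gamma(c;\underline d),F)$ where $F$ is the unique map with $F\circ\lambda=\lambda\circ f$ and $F\circ\mu_i=\mu_i\circ g_i$ for all $i$. *)

(* Defs.v *)
From HB Require Import structures.
From mathcomp Require Import all_boot all_order all_fingroup.
From mathcomp Require Import all_classical topology.

Set Implicit Arguments.
Unset Strict Implicit.
Unset Printing Implicit Defensive.

Local Open Scope classical_set_scope.

Definition coprod (I : choiceType) (T : I -> topologicalType) : topologicalType :=
  {i : I & T i}.

(* The square  h \o f = k \o g  is a pushout of topological spaces. *)
Definition is_pushout (A B C D : topologicalType)
    (f : A -> B) (g : A -> C) (h : B -> D) (k : C -> D) : Prop :=
  [/\ continuous f, continuous g, continuous h, continuous k & h \o f = k \o g] /\
  forall (Z : topologicalType) (u : B -> Z) (v : C -> Z),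
    continuous u -> continuous v -> u \o f = v \o g ->
    exists! w : D -> Z, [/\ continuous w, w \o h = u & w \o k = v].

Definition is_homeo (A B : topologicalType) (f : A -> B) : Prop :=
  continuous f /\ exists g : B -> A, [/\ continuous g, cancel f g & cancel g f].

(* A space over B, in which the fibre over b is given as a space [fib b]
   identified, through [inc], with the subspace of the total space lying over b.
   With the fibres as part of the data, the fibre of a pullback along f over a is
   the fibre over f a itself. *)
Record fibred (B : topologicalType) := Fibred {
  tot : topologicalType;
  pr : tot -> B;
  fib :> B -> topologicalType;
  inc : forall b : B, fib b -> tot;
  pr_continuous : continuous pr;
  inc_inj : forall b : B, injective (@inc b);
  inc_range : forall b : B, range (@inc b) = pr @^-1` [set b];
  inc_open : forall (b : B) (A : set (fib b)),
    open A <-> exists2 O : set tot, open O & @inc b @^-1` O = A }.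

Arguments pr {B} f.
Arguments inc {B f b}.

Lemma fib_ptP (B : topologicalType) (U : fibred B) (u : tot U) :
  exists v : U (pr U u), inc v = u.
Proof.
have [v _ vu] : range (@inc B U (pr U u)) u by rewrite inc_range.
by exists v.
Qed.

Definition fib_pt (B : topologicalType) (U : fibred B) (u : tot U) : U (pr U u) :=
  projT1 (cid (fib_ptP u)).

(* The function on total spaces induced by functions between fibres. *)
Definition totmap (B : topologicalType) (U V : fibred B)
    (phi : forall b : B, U b -> V b) (u : tot U) : tot V :=
  inc (phi _ (fib_pt u)).

Section Pullback.
Variables (A B : topologicalType) (f : A -> B) (U : fibred B).

Definition pullback_tot : topologicalType :=
  [set p : (A * tot U)%type | f p.1 = pr U p.2].

Definition pullback_pr (p : pullback_tot) : A := (set_val p).1.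

Lemma pr_inc (b : B) (v : U b) : pr U (inc v) = b.
Proof.
have : range (@inc B U b) (inc v) by exists v.
by rewrite inc_range.
Qed.

Definition pullback_inc (a : A) (v : U (f a)) : pullback_tot :=
  SigSub (mem_set (esym (pr_inc v) : [set p : A * tot U | f p.1 = pr U p.2] (a, inc v))).

Lemma pullback_pr_continuous : continuous pullback_pr.
Proof.
move=> p; apply: (@continuous_comp _ _ _ (set_val : pullback_tot -> _) fst).
  exact: initial_continuous.
exact: cvg_fst.
Qed.

Lemma pullback_inc_inj (a : A) : injective (@pullback_inc a).
Proof. by move=> v w /(congr1 (fun p => (set_val p).2)) /inc_inj. Qed.

Lemma pullback_inc_range (a : A) :
  range (@pullback_inc a) = pullback_pr @^-1` [set a].
Proof.
apply/seteqP; split=> [p [v _ <-]|p /= pa]; first by [].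
rewrite -{}pa.
have [v _ ev] : range (@inc B U (f (pullback_pr p))) (set_val p).2.
  by rewrite inc_range; exact/esym/(set_valP p).
exists v; first by [].
by apply: val_inj; rewrite [RHS]surjective_pairing -[X in (_, X)]ev.
Qed.

Lemma pullback_inc_open (a : A) (S : set (U (f a))) :
  open S <-> exists2 O : set pullback_tot, open O & @pullback_inc a @^-1` O = S.
Proof.
split=> [/inc_open [O oO <-]|[_ [O oO <-] <-]].
  exists ((fun p : pullback_tot => (set_val p).2) @^-1` O) => //.
  exists (snd @^-1` O) => //; apply: open_comp => // x _; exact: cvg_snd.
have -> : @pullback_inc a @^-1` (set_val @^-1` O)
    = @inc _ U (f a) @^-1` ((fun u => (a, u)) @^-1` O) by [].
apply/inc_open; exists ((fun u => (a, u)) @^-1` O) => //.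
apply: open_comp => // x _; apply: cvg_pair => //; exact: cvg_cst.
Qed.

Definition pullback : fibred A :=
  Fibred pullback_pr_continuous pullback_inc_inj pullback_inc_range
         pullback_inc_open.

End Pullback.

(* K, a subset of U, lies over W and is fibrewise compact over W: its projection
   K -> W is a closed map with compact fibres. *)
Definition fibrewise_compact_over (B : topologicalType) (U : fibred B)
    (W : set B) (K : set (tot U)) : Prop :=
  [/\ K `<=` pr U @^-1` W,
      (forall C : set (tot U), closed C ->
         exists2 D : set B, closed D & pr U @` (C `&` K) = D `&` W)
    & forall b : B, W b -> compact (K `&` pr U @^-1` [set b])].

Definition fibrewise_compact (B : topologicalType) (U : fibred B) : Prop :=
  (forall C : set (tot U), closed C -> closed (pr U @` C)) /\
  (forall b : B, compact (pr U @^-1` [set b])).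

Definition fibrewise_hausdorff (B : topologicalType) (U : fibred B) : Prop :=
  forall u v : tot U, pr U u = pr U v -> u <> v ->
    exists O O' : set (tot U), [/\ open O, open O', O u, O' v & O `&` O' = set0].

Section MapSpace.
Variables (B : topologicalType) (U V : fibred B).

Record map_over := MapOver {
  mo_base : B;
  mo_fun : U mo_base -> V mo_base;
  mo_continuous : continuous mo_fun }.

Definition map_over_basic (W : set B) (K : set (tot U)) (O : set (tot V)) :
    set map_over :=
  [set phi | W (mo_base phi) /\
             forall u : U (mo_base phi), K (inc u) -> O (inc (mo_fun u))].

Definition map_over_subbase : set (set map_over) :=
  [set S | exists (W : set B) (K : set (tot U)) (O : set (tot V)),
     [/\ open W, fibrewise_compact_over W K, open O, O `<=` pr V @^-1` W
       & S = map_over_basic W K O]].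

HB.instance Definition _ := gen_eqMixin map_over.
HB.instance Definition _ := gen_choiceMixin map_over.
HB.instance Definition _ :=
  isSubBaseTopological.Build map_over map_over_subbase id.

End MapSpace.

(* Indices are 0-based.  If N = m_0 + ... + m_(n-1), [blk e i j] is the element
   m_0 + ... + m_(i-1) + j of {0, ..., N-1}. *)
Definition blk (n : nat) (m : 'I_n -> nat) (N : nat) (e : \sum_(i < n) m i = N)
    (i : 'I_n) (j : 'I_(m i)) : 'I_N :=
  cast_ord e (tagnat.Rank i j).

Section BlockPermutations.
Variables (n : nat) (m : 'I_n -> nat) (N : nat).

Lemma blk_inj (e : \sum_(i < n) m i = N) (p q : {i : 'I_n & 'I_(m i)}) :
  blk e (tagged p) = blk e (tagged q) -> p = q.
Proof.
by case: p => i j; case: q => i' j' /cast_ord_inj /tagnat.rank_inj.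
Qed.

Section DirectSum.
Variables (e : \sum_(i < n) m i = N) (s : forall i : 'I_n, {perm 'I_(m i)}).

Definition bsum_fun (k : 'I_N) : 'I_N :=
  let p := tagnat.sig (cast_ord (esym e) k) in blk e (s (tag p) (tagged p)).

Lemma bsum_fun_inj : injective bsum_fun.
Proof.
move=> k k' /(@blk_inj e (Tagged _ _) (Tagged _ _)) E.
apply/(@cast_ord_inj _ _ (esym e))/tagnat.sig_inj; move: E.
case: (tagnat.sig _) => i j; case: (tagnat.sig _) => i' j' /= E.
have ii' : i = i' := congr1 tag E.
case: _ / ii' j' E => j' E; congr (Tagged _ _).
exact: perm_inj (eq_from_Tagged E).
Qed.

(* s_0 (+) ... (+) s_(n-1) *)
Definition bsum : {perm 'I_N} := perm bsum_fun_inj.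

Lemma bsumE (i : 'I_n) (j : 'I_(m i)) : bsum (blk e j) = blk e (s i j).
Proof. by rewrite permE /bsum_fun /blk cast_ordK tagnat.rankK. Qed.

End DirectSum.

Section BlockPermutation.
Variables (s : {perm 'I_n}) (e : \sum_(k < n) m ((s^-1)%g k) = N)
  (e' : \sum_(i < n) m i = N).

Definition bperm_inv_fun (k : 'I_N) : 'I_N :=
  let p := tagnat.sig (cast_ord (esym e) k) in
  @blk n m N e' ((s^-1)%g (tag p)) (tagged p).

Lemma bperm_inv_fun_inj : injective bperm_inv_fun.
Proof.
move=> k k' /(@blk_inj e' (@Tagged _ ((s^-1)%g _) (fun i => 'I_(m i)) _)
                          (@Tagged _ ((s^-1)%g _) (fun i => 'I_(m i)) _)) E.
apply/(@cast_ord_inj _ _ (esym e))/tagnat.sig_inj; move: E.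
case: (tagnat.sig _) => i j; case: (tagnat.sig _) => i' j' /= E.
have ii' : i = i' := perm_inj (congr1 tag E).
case: _ / ii' j' E => j' E; congr (Tagged _ _).
exact: eq_from_Tagged E.
Qed.

(* The block permutation s(m_0, ..., m_(n-1)): it moves the i-th block, of size
   m_i, to the place of the (s i)-th block among blocks of sizes
   m_(s^-1 0), ..., m_(s^-1 (n-1)), preserving the order inside blocks. *)
Definition bperm : {perm 'I_N} := (perm bperm_inv_fun_inj)^-1%g.

Lemma bpermE (k : 'I_n) (j : 'I_(m ((s^-1)%g k))) :
  bperm (blk e' j) = @blk n (fun k => m ((s^-1)%g k)) N e k j.
Proof.
apply: (@perm_inj _ (perm bperm_inv_fun_inj)); rewrite permKV permE.
by rewrite /bperm_inv_fun {2}/blk cast_ordK tagnat.rankK.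
Qed.

End BlockPermutation.
End BlockPermutations.

(* Composition takes its value in degree N for any N given with a proof that
   N = m_0 + ... + m_(n-1).  As N is free in that equation, this is the same as a
   value in degree \sum_i m i, and the axioms, which compare degrees that are
   equal but not convertible, need no transport.
   In 'S_n the product s * t is "s, then t": the composite t s of the right action
   convention (x t) s = x (t s) is written (s * t)%g. *)
Record operad_on (O : nat -> topologicalType) := OperadOn {
  act_on : forall n : nat, O n -> {perm 'I_n} -> O n;
  unit_on : O 1;
  comp_on : forall (n : nat) (m : 'I_n -> nat) (N : nat),
    \sum_(i < n) m i = N -> O n -> (forall i : 'I_n, O (m i)) -> O N;

  act_on_continuous : forall (n : nat) (s : {perm 'I_n}),
    continuous (fun x : O n => act_on x s);
  comp_on_continuous : forall (n : nat) (m : 'I_n -> nat) (N : nat)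
      (e : \sum_(i < n) m i = N),
    continuous (fun p : (O n * prod_topology (fun i : 'I_n => O (m i)))%type =>
                  comp_on e p.1 p.2);

  act_on1 : forall (n : nat) (x : O n), act_on x 1%g = x;
  act_onM : forall (n : nat) (x : O n) (s t : {perm 'I_n}),
    act_on (act_on x t) s = act_on x (s * t)%g;

  comp_on1l : forall (n : nat) (e : \sum_(i < 1) n = n) (y : O n),
    comp_on e unit_on (fun=> y) = y;
  comp_on1r : forall (n : nat) (e : \sum_(i < n) 1 = n) (x : O n),
    comp_on e x (fun=> unit_on) = x;
  comp_onA : forall (n : nat) (m : 'I_n -> nat)
      (l : forall i : 'I_n, 'I_(m i) -> nat) (L : 'I_n -> nat) (N : nat)
      (e1 : \sum_(k < \sum_(i < n) m i) l (tagnat.sig1 k) (tagnat.sig2 k) = N)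
      (e2 : forall i : 'I_n, \sum_(j < m i) l i j = L i)
      (e3 : \sum_(i < n) L i = N)
      (x : O n) (y : forall i : 'I_n, O (m i))
      (z : forall (i : 'I_n) (j : 'I_(m i)), O (l i j)),
    comp_on e1 (comp_on erefl x y) (fun k => z (tagnat.sig1 k) (tagnat.sig2 k))
    = comp_on e3 x (fun i => comp_on (e2 i) (y i) (z i));

  comp_on_act_inner : forall (n : nat) (m : 'I_n -> nat) (N : nat)
      (e : \sum_(i < n) m i = N) (x : O n) (y : forall i : 'I_n, O (m i))
      (s : forall i : 'I_n, {perm 'I_(m i)}),
    comp_on e x (fun i => act_on (y i) (s i)) = act_on (comp_on e x y) (bsum e s);
  comp_on_act_outer : forall (n : nat) (m : 'I_n -> nat) (N : nat)
      (s : {perm 'I_n}) (e : \sum_(k < n) m ((s^-1)%g k) = N)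
      (e' : \sum_(i < n) m i = N) (x : O n) (y : forall i : 'I_n, O (m i)),
    act_on (comp_on e x (fun k => y ((s^-1)%g k))) (bperm e e')
    = comp_on e' (act_on x s) y }.

Record operad := Operad {
  ospace :> nat -> topologicalType;
  ostr : operad_on ospace }.

Definition oact (O : operad) (n : nat) (x : O n) (s : {perm 'I_n}) : O n :=
  act_on (ostr O) x s.
Definition ounit (O : operad) : O 1 := unit_on (ostr O).
Definition ocomp (O : operad) (n : nat) (m : 'I_n -> nat) (N : nat)
    (e : \sum_(i < n) m i = N) (x : O n) (y : forall i : 'I_n, O (m i)) : O N :=
  comp_on (ostr O) e x y.

Arguments ounit O : clear implicits.

Definition is_operad_morphism (P Q : operad) (f : forall n : nat, P n -> Q n) :
    Prop :=
  [/\ (forall n : nat, continuous (f n)),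
      (forall (n : nat) (x : P n) (s : {perm 'I_n}), f n (oact x s) = oact (f n x) s),
      f 1 (ounit P) = ounit Q
    & forall (n : nat) (m : 'I_n -> nat) (N : nat) (e : \sum_(i < n) m i = N)
        (x : P n) (y : forall i : 'I_n, P (m i)),
        f N (ocomp e x y) = ocomp e (f n x) (fun i => f (m i) (y i))].

(* The base O(n) x O(m_0) x ... x O(m_(n-1)) of the squares of pasting maps. *)
Definition comp_base (O : operad) (n : nat) (m : 'I_n -> nat) : topologicalType :=
  (O n * prod_topology (fun i : 'I_n => O (m i)))%type.

(* The space |x| is [ro n x], the fibre of [ro n] over x.  Points of fibres |x| and
   |x'| with x and x' equal but not convertible are compared in the total space,
   through [inc]. *)
Record realization (X : topologicalType) (O : operad) := Realization {
  ro : forall n : nat, fibred (O n);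

  bd_in : forall (n : nat) (x : O n), 'I_n -> X -> ro n x;
  bd_out : forall (n : nat) (x : O n), X -> ro n x;
  symm : forall (n : nat) (s : {perm 'I_n}) (x : O n), ro n x -> ro n (oact x s);
  lam : forall (n : nat) (m : 'I_n -> nat) (N : nat) (e : \sum_(i < n) m i = N)
      (x : O n) (y : forall i : 'I_n, O (m i)),
    ro n x -> ro N (ocomp e x y);
  mu : forall (n : nat) (m : 'I_n -> nat) (N : nat) (e : \sum_(i < n) m i = N)
      (x : O n) (y : forall i : 'I_n, O (m i)) (i : 'I_n),
    ro (m i) (y i) -> ro N (ocomp e x y);

  ro_compact : forall n : nat, fibrewise_compact (ro n);
  ro_hausdorff : forall n : nat, fibrewise_hausdorff (ro n);
  bd_in_continuous : forall (n : nat) (i : 'I_n),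
    continuous (fun p : (O n * X)%type => inc (bd_in p.1 i p.2) : tot (ro n));
  bd_out_continuous : forall n : nat,
    continuous (fun p : (O n * X)%type => inc (bd_out p.1 p.2) : tot (ro n));
  symm_continuous : forall (n : nat) (s : {perm 'I_n}),
    continuous (@totmap _ (ro n) (pullback (fun x : O n => oact x s) (ro n))
                  (fun x => @symm n s x));
  lam_continuous : forall (n : nat) (m : 'I_n -> nat) (N : nat)
      (e : \sum_(i < n) m i = N),
    continuous (@totmap (comp_base O m)
                  (pullback (fun b : comp_base O m => b.1) (ro n))
                  (pullback (fun b : comp_base O m => ocomp e b.1 b.2) (ro N))
                  (fun b => @lam n m N e b.1 b.2));
  mu_continuous : forall (n : nat) (m : 'I_n -> nat) (N : nat)
      (e : \sum_(i < n) m i = N) (i : 'I_n),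
    continuous (@totmap (comp_base O m)
                  (pullback (fun b : comp_base O m => b.2 i) (ro (m i)))
                  (pullback (fun b : comp_base O m => ocomp e b.1 b.2) (ro N))
                  (fun b => @mu n m N e b.1 b.2 i));

  pasting_pushout : forall (n : nat) (m : 'I_n -> nat) (N : nat)
      (e : \sum_(i < n) m i = N) (x : O n) (y : forall i : 'I_n, O (m i)),
    @is_pushout (coprod (fun _ : 'I_n => X))
                (coprod (fun i : 'I_n => ro (m i) (y i)))
                (ro n x)
                (ro N (ocomp e x y))
      (fun p => existT _ (tag p) (bd_out (y (tag p)) (tagged p)))
      (fun p => bd_in x (tag p) (tagged p))
      (fun p => @mu n m N e x y (tag p) (tagged p))
      (@lam n m N e x y);
  (* The fibrewise pushout is a pushout of the total spaces; its maps lie over the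
     base by construction. *)
  pasting_fibrewise_pushout : forall (n : nat) (m : 'I_n -> nat) (N : nat)
      (e : \sum_(i < n) m i = N),
    let B := comp_base O m in
    let R := pullback (fun b : B => b.1) (ro n) in
    let S := fun i : 'I_n => pullback (fun b : B => b.2 i) (ro (m i)) in
    let T := pullback (fun b : B => ocomp e b.1 b.2) (ro N) in
    @is_pushout (coprod (fun _ : 'I_n => (B * X)%type))
                (coprod (fun i : 'I_n => tot (S i)))
                (tot R)
                (tot T)
      (fun p => existT (fun i => tot (S i)) (tag p)
         (@inc _ (S (tag p)) (tagged p).1
            (bd_out ((tagged p).1.2 (tag p)) (tagged p).2)))
      (fun p => @inc _ R (tagged p).1 (bd_in (tagged p).1.1 (tag p) (tagged p).2))
      (fun p => @totmap B (S (tag p)) T (fun b => @mu n m N e b.1 b.2 (tag p))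
                  (tagged p))
      (@totmap B R T (fun b => @lam n m N e b.1 b.2));

  unit_homeo :
    bd_in (ounit O) ord0 = bd_out (ounit O) /\ is_homeo (bd_out (ounit O));
  mu_unit_l : forall (n : nat) (e : \sum_(i < 1) n = n) (y : O n) (u : ro n y),
    inc (@mu 1 (fun=> n) n e (ounit O) (fun=> y) ord0 u) = inc u;
  lam_unit_l : forall (n : nat) (e : \sum_(i < 1) n = n) (y : O n) (t : X),
    inc (@lam 1 (fun=> n) n e (ounit O) (fun=> y) (bd_in (ounit O) ord0 t))
    = inc (bd_out y t);
  lam_unit_r : forall (n : nat) (e : \sum_(i < n) 1 = n) (x : O n) (u : ro n x),
    inc (@lam n (fun=> 1) n e x (fun=> ounit O) u) = inc u;
  mu_unit_r : forall (n : nat) (e : \sum_(i < n) 1 = n) (x : O n) (i : 'I_n) (t : X),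
    inc (@mu n (fun=> 1) n e x (fun=> ounit O) i (bd_out (ounit O) t))
    = inc (bd_in x i t);

  symm_symm : forall (n : nat) (s t : {perm 'I_n}) (x : O n) (u : ro n x),
    inc (symm s (symm t u)) = inc (symm (s * t)%g u);
  symm_bd_in : forall (n : nat) (s : {perm 'I_n}) (x : O n) (i : 'I_n) (t : X),
    symm s (bd_in x i t) = bd_in (oact x s) ((s^-1)%g i) t;
  symm_bd_out : forall (n : nat) (s : {perm 'I_n}) (x : O n) (t : X),
    symm s (bd_out x t) = bd_out (oact x s) t;

  lam_bd_out : forall (n : nat) (m : 'I_n -> nat) (N : nat)
      (e : \sum_(i < n) m i = N) (x : O n) (y : forall i : 'I_n, O (m i)) (t : X),
    lam e y (bd_out x t) = bd_out (ocomp e x y) t;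
  mu_bd_in : forall (n : nat) (m : 'I_n -> nat) (N : nat)
      (e : \sum_(i < n) m i = N) (x : O n) (y : forall i : 'I_n, O (m i))
      (i : 'I_n) (j : 'I_(m i)) (t : X),
    mu e x (bd_in (y i) j t) = bd_in (ocomp e x y) (blk e j) t;

  lam_symm_inner : forall (n : nat) (m : 'I_n -> nat) (N : nat)
      (e : \sum_(i < n) m i = N) (x : O n) (y : forall i : 'I_n, O (m i))
      (s : forall i : 'I_n, {perm 'I_(m i)}) (u : ro n x),
    inc (symm (bsum e s) (lam e y u)) = inc (lam e (fun i => oact (y i) (s i)) u);
  mu_symm_inner : forall (n : nat) (m : 'I_n -> nat) (N : nat)
      (e : \sum_(i < n) m i = N) (x : O n) (y : forall i : 'I_n, O (m i))
      (s : forall i : 'I_n, {perm 'I_(m i)}) (i : 'I_n) (u : ro (m i) (y i)),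
    inc (symm (bsum e s) (@mu n m N e x y i u))
    = inc (@mu n m N e x (fun i => oact (y i) (s i)) i (symm (s i) u));

  lam_symm_outer : forall (n : nat) (m : 'I_n -> nat) (N : nat)
      (s : {perm 'I_n}) (e : \sum_(k < n) m ((s^-1)%g k) = N)
      (e' : \sum_(i < n) m i = N) (x : O n) (y : forall i : 'I_n, O (m i))
      (u : ro n x),
    inc (symm (bperm e e') (lam e (fun k => y ((s^-1)%g k)) u))
    = inc (lam e' y (symm s u));
  (* Indexed by k = s i, for u in |y_i| with i = s^-1 k. *)
  mu_symm_outer : forall (n : nat) (m : 'I_n -> nat) (N : nat)
      (s : {perm 'I_n}) (e : \sum_(k < n) m ((s^-1)%g k) = N)
      (e' : \sum_(i < n) m i = N) (x : O n) (y : forall i : 'I_n, O (m i))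
      (k : 'I_n) (u : ro (m ((s^-1)%g k)) (y ((s^-1)%g k))),
    inc (symm (bperm e e')
           (@mu n (fun k => m ((s^-1)%g k)) N e x (fun k => y ((s^-1)%g k)) k u))
    = inc (@mu n m N e' (oact x s) y ((s^-1)%g k) u);

  assoc_lam_lam : forall (n : nat) (m : 'I_n -> nat)
      (l : forall i : 'I_n, 'I_(m i) -> nat) (L : 'I_n -> nat) (N : nat)
      (e1 : \sum_(k < \sum_(i < n) m i) l (tagnat.sig1 k) (tagnat.sig2 k) = N)
      (e2 : forall i : 'I_n, \sum_(j < m i) l i j = L i)
      (e3 : \sum_(i < n) L i = N)
      (x : O n) (y : forall i : 'I_n, O (m i))
      (z : forall (i : 'I_n) (j : 'I_(m i)), O (l i j)) (u : ro n x),
    inc (lam e1 (fun k => z (tagnat.sig1 k) (tagnat.sig2 k)) (lam erefl y u))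
    = inc (lam e3 (fun i => ocomp (e2 i) (y i) (z i)) u);
  assoc_lam_mu : forall (n : nat) (m : 'I_n -> nat)
      (l : forall i : 'I_n, 'I_(m i) -> nat) (L : 'I_n -> nat) (N : nat)
      (e1 : \sum_(k < \sum_(i < n) m i) l (tagnat.sig1 k) (tagnat.sig2 k) = N)
      (e2 : forall i : 'I_n, \sum_(j < m i) l i j = L i)
      (e3 : \sum_(i < n) L i = N)
      (x : O n) (y : forall i : 'I_n, O (m i))
      (z : forall (i : 'I_n) (j : 'I_(m i)), O (l i j))
      (i : 'I_n) (u : ro (m i) (y i)),
    inc (lam e1 (fun k => z (tagnat.sig1 k) (tagnat.sig2 k)) (@mu n m _ erefl x y i u))
    = inc (@mu n L N e3 x (fun i => ocomp (e2 i) (y i) (z i)) i (lam (e2 i) (z i) u));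
  (* k stands for the pair (i, j) = (sig1 k, sig2 k). *)
  assoc_mu_mu : forall (n : nat) (m : 'I_n -> nat)
      (l : forall i : 'I_n, 'I_(m i) -> nat) (L : 'I_n -> nat) (N : nat)
      (e1 : \sum_(k < \sum_(i < n) m i) l (tagnat.sig1 k) (tagnat.sig2 k) = N)
      (e2 : forall i : 'I_n, \sum_(j < m i) l i j = L i)
      (e3 : \sum_(i < n) L i = N)
      (x : O n) (y : forall i : 'I_n, O (m i))
      (z : forall (i : 'I_n) (j : 'I_(m i)), O (l i j))
      (k : 'I_(\sum_(i < n) m i))
      (u : ro (l (tagnat.sig1 k) (tagnat.sig2 k))
              (z (tagnat.sig1 k) (tagnat.sig2 k))),
    inc (@mu _ _ N e1 (ocomp erefl x y)
           (fun k => z (tagnat.sig1 k) (tagnat.sig2 k)) k u)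
    = inc (@mu n L N e3 x (fun i => ocomp (e2 i) (y i) (z i)) (tagnat.sig1 k)
             (@mu _ _ _ (e2 (tagnat.sig1 k)) (y (tagnat.sig1 k))
                (z (tagnat.sig1 k)) (tagnat.sig2 k) u)) }.

Section MappingSpace.
Variables (X : topologicalType) (P Q : operad).
Variables (RP : realization X P) (RQ : realization X Q) (n : nat).

Record mapping := Mapping {
  msrc : P n;
  mtgt : Q n;
  mfun : ro RP n msrc -> ro RQ n mtgt;
  mfun_continuous : continuous mfun;
  mfun_bd_in : forall (i : 'I_n) (t : X), mfun (bd_in RP msrc i t) = bd_in RQ mtgt i t;
  mfun_bd_out : forall t : X, mfun (bd_out RP msrc t) = bd_out RQ mtgt t }.

Definition mapping_over (phi : mapping) :
    map_over (pullback (fun b : (P n * Q n)%type => b.1) (ro RP n))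
             (pullback (fun b : (P n * Q n)%type => b.2) (ro RQ n)) :=
  @MapOver (P n * Q n)%type
    (pullback (fun b : (P n * Q n)%type => b.1) (ro RP n))
    (pullback (fun b : (P n * Q n)%type => b.2) (ro RQ n))
    (msrc phi, mtgt phi) (@mfun phi) (@mfun_continuous phi).

HB.instance Definition _ := gen_eqMixin mapping.
HB.instance Definition _ := gen_choiceMixin mapping.
HB.instance Definition _ :=
  Topological.copy mapping (initial_topology mapping_over).

End MappingSpace.

Definition mapping_space (X : topologicalType) (P Q : operad)
    (RP : realization X P) (RQ : realization X Q) : nat -> topologicalType :=
  fun n => mapping RP RQ n.

Section MappingOperad.
Variables (X : topologicalType) (P Q : operad).
Variables (RP : realization X P) (RQ : realization X Q).

Definition mapping_act_spec (n : nat) (phi : mapping RP RQ n) (s : {perm 'I_n})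
    (psi : mapping RP RQ n) : Prop :=
  exists h : ro RP n (oact (msrc phi) s) -> ro RP n (msrc phi),
    [/\ cancel (@symm _ _ RP n s (msrc phi)) h, cancel h (@symm _ _ RP n s (msrc phi))
      & exists c i o,
          psi = @Mapping _ _ _ RP RQ n (oact (msrc phi) s) (oact (mtgt phi) s)
                  (@symm _ _ RQ n s (mtgt phi) \o @mfun _ _ _ _ _ _ phi \o h) c i o].

Definition mapping_unit_spec (psi : mapping RP RQ 1) : Prop :=
  exists (f : ro RP 1 (ounit P) -> ro RQ 1 (ounit Q)) c i o,
    f \o bd_out RP (ounit P) = bd_out RQ (ounit Q) /\
    psi = @Mapping _ _ _ RP RQ 1 (ounit P) (ounit Q) f c i o.

Definition mapping_comp_spec (n : nat) (m : 'I_n -> nat) (N : nat)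
    (e : \sum_(i < n) m i = N) (phi : mapping RP RQ n)
    (psi : forall i : 'I_n, mapping RP RQ (m i)) (chi : mapping RP RQ N) : Prop :=
  let a := msrc phi in let b := fun i => msrc (psi i) in
  let c := mtgt phi in let d := fun i => mtgt (psi i) in
  exists F : ro RP N (ocomp e a b) -> ro RQ N (ocomp e c d),
    unique (fun G : ro RP N (ocomp e a b) -> ro RQ N (ocomp e c d) =>
              [/\ continuous G,
                  G \o @lam _ _ RP n m N e a b
                  = @lam _ _ RQ n m N e c d \o @mfun _ _ _ _ _ _ phi
                & forall i : 'I_n,
                  G \o @mu _ _ RP n m N e a b i
                  = @mu _ _ RQ n m N e c d i \o @mfun _ _ _ _ _ _ (psi i)]) F /\
    exists k i o,
      chi = @Mapping _ _ _ RP RQ N (ocomp e a b) (ocomp e c d) F k i o.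

End MappingOperad.

(* Main.v *)
Require Import Defs.
From HB Require Import structures.
From mathcomp Require Import all_boot all_order all_fingroup.
From mathcomp Require Import all_classical topology.
Import Defs.
Local Open Scope classical_set_scope.

Set Implicit Arguments.
Unset Strict Implicit.
Unset Printing Implicit Defensive.

(** Compositions exist because each composite of operations in [P] comes with a
    pushout square in [RP]: the maps [lam \o f] and [mu \o g_i] agree on the
    glued boundaries, so they define a unique map [F] on the pasted space.

    Every axiom of an operad is an equality of two mappings whose sources are
    equal but live over different expressions, such as both bracketings of a
    triple composite.  Equality is therefore tested on graphs in the total
    spaces of [RP] and [RQ] ([mapping_ext]).  As the images of [lam] and of the
    [mu_i] cover a pasted space ([pushout_cover]), it is enough to compare graphs
    on these images, where the composites are known explicitly and the matching
    axiom of realization systems, used once for [RP] and once for [RQ], gives the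
    answer.  The action needs inverses of the symmetry maps, hence that the
    identity permutation acts as the identity on each |x|; this follows from the
    compatibility of [mu] with outer permutations for the composite of the unit
    with x, where [mu] is the identity ([symm1]).

    Continuity rests on the exponential law for the fibrewise compact-open
    topology.  For U fibrewise compact and fibrewise Hausdorff, evaluation
    Map_B(U, V) x_B U -> V is continuous ([map_over_eval]).  Conversely, a
    function from Z to Map_B(U, V) is continuous once its base component
    Z -> B and its adjoint Z x_B U -> V are ([continuous_to_map_over]).  The
    converse uses the tube lemma for closed maps with compact fibres
    ([tube_over]).  A composite F of f and g_1, ..., g_n depends continuously on
    them because [lam] and the [mu_i] are, over the base, closed maps with compact
    fibres: they go from fibrewise compact spaces to a fibrewise Hausdorff one
    and remain such after any base change.  Together they cover the pasted
    spaces, so F is continuous on the total family as soon as F \o lam = lam \o f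
    and F \o mu_i = mu_i \o g_i are; [family_preimage_near] is the form of this
    quotient argument that is used. *)

Local Notation mfun_of phi := (@mfun _ _ _ _ _ _ phi).

(** * Compactness, products and pushouts *)

(** A neighbourhood of [y0] that is good for one point of K and for the points near
    it can be shrunk freely, so compactness is applied with the filter of small
    neighbourhoods of [y0] as index. *)
Lemma compact_tube (Y T : topologicalType) (K : set T) (y0 : Y)
    (P : Y -> T -> Prop) :
  compact K ->
  (forall u, K u -> \forall y \near y0 & u' \near u, P y u') ->
  exists G : set T, [/\ open G, K `<=` G
    & \forall y \near y0, forall u, G u -> P y u].
Proof.
move=> /compact_near_coveringP cK KP.
have /= [N nN KN] : exists2 N : set Y, nbhs y0 N &
    forall u, K u -> \forall u' \near u, forall y, N y -> P y u'.
  apply/near_powerset_filter_fromP.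
    move=> A C AC CP u /CP; apply: filterS => u' h y /AC; exact: h.
  apply: (cK (set Y) _ (fun N u => \forall u' \near u, forall y, N y -> P y u')).
  move=> u /KP [[A C] /= [nA nC] ACP].
  exists (C°%classic, [set N | N `<=` A]) => /=.
    split; first exact: nbhs_interior.
    exact: small_set_sub.
  move=> [u1 N] /= [Cu1 NA]; apply: filterS Cu1 => u2 Cu2 y Ny.
  by apply: (ACP (y, u2)); split => //=; exact: NA.
exists [set u | forall y, N y -> P y u]°%classic; split.
- exact: open_interior.
- by move=> u /KN.
- by apply: filterS nN => y Ny u /interior_subset; exact.
Qed.

Lemma continuous_to_prod (Z : topologicalType) (I : Type) (T : I -> topologicalType)
    (h : Z -> prod_topology T) :
  (forall i, continuous (fun z => h z i)) -> continuous h.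
Proof.
move=> ch z; apply/cvg_sup => i A [_ [[O oO <-] Oz OA]].
apply: filterS OA _.
have nO : nbhs (h z i) O by apply: open_nbhs_nbhs.
exact: (ch i z O nO).
Qed.

Lemma continuous_pair (Z A B : topologicalType) (f : Z -> A) (g : Z -> B) :
  continuous f -> continuous g -> continuous (fun z => (f z, g z)).
Proof. by move=> cf cg z; apply: cvg_pair; [exact: cf|exact: cg]. Qed.

(** A map into an indiscrete space is arbitrary, so a pushout of spaces is a pushout
    of sets: the indicator of the union of the two images and the constant
    function [true] agree on both of them, hence are equal. *)
Lemma pushout_cover (A B C D : topologicalType) (f : A -> B) (g : A -> C) (h : B -> D)
    (k : C -> D) : is_pushout f g h k ->
  forall d, (exists b, d = h b) \/ (exists c, d = k c).
Proof.
move=> [_ /(_ (initial_topology (fun _ : bool => false)))].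
have cont (T : topologicalType) (w : T -> initial_topology (fun _ : bool => false)) :
    continuous w.
  apply/continuousP => _ [S _ <-].
  have [Sf|nSf] := pselect (S false).
    by rewrite [X in open X](_ : _ = setT); [exact: openT|apply/seteqP; split].
  by rewrite [X in open X](_ : _ = set0); [exact: open0|apply/seteqP; split].
move=> /(_ (fun=> true) (fun=> true) (cont _ _) (cont _ _) erefl) [w [_ wU]] d.
pose w' d : initial_topology (fun _ : bool => false) :=
  `[< (exists b, d = h b) \/ (exists c, d = k c) >].
have w1 : w = fun=> true by apply: wU.
have w2 : w = w'.
  apply: wU; split => //; apply/funext => x /=; apply/asboolP.
    by left; exists x.
  by right; exists x.
have : w' d = true by rewrite -w2 w1.
by move/asboolP.
Qed.

(** * Block permutations *)

Lemma blkP n (m : 'I_n -> nat) N (e : \sum_(i < n) m i = N) (k : 'I_N) :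
  exists i (j : 'I_(m i)), k = blk e j.
Proof.
exists (tagnat.sig1 (cast_ord (esym e) k)), (tagnat.sig2 (cast_ord (esym e) k)).
by rewrite /blk tagnat.sig2K cast_ordKV.
Qed.

Lemma bperm1 n (m : 'I_n -> nat) N (e : \sum_(k < n) m ((1^-1 : {perm 'I_n})%g k) = N)
    (e' : \sum_(i < n) m i = N) :
  @bperm n m N 1%g e e' = 1%g.
Proof.
apply/permP => l; rewrite perm1.
have [k [j ->]] := blkP e l.
(* Both positions are sums of the sizes of the earlier blocks, plus j. *)
have jE : @blk n m N e' _ j = blk e j.
  apply: val_inj; rewrite [LHS](tagnat.RankEsum j) [RHS]tagnat.RankEsum.
  have id1 (i : 'I_n) : (1^-1 : {perm 'I_n})%g i = i by rewrite invg1 perm1.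
  by congr (_ + _)%N; apply: eq_big => i; rewrite !id1.
by rewrite -{1}jE bpermE.
Qed.

(** * Spaces over a base *)

Section FibredBasics.
Variable B : topologicalType.
Implicit Types U V : fibred B.

Lemma inc_fib_pt U (u : tot U) : inc (fib_pt u) = u.
Proof. by rewrite /fib_pt; case: cid. Qed.

(** Points of fibres over equal but not convertible base points are compared in the
    total space, and there every family of functions on fibres respects equality. *)
Lemma inc_congr U (T : Type) (phi : forall b, U b -> T) (b b' : B) (v : U b) (v' : U b') :
  inc v = inc v' -> phi b v = phi b' v'.
Proof.
move=> vv'; have bb' : b = b' by rewrite -(pr_inc v) vv' pr_inc.
by case: b' / bb' v' vv' => v' /inc_inj ->.
Qed.

Lemma inc_onto U (b : B) (u : tot U) : pr U u = b -> exists v : U b, inc v = u.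
Proof.
by move=> ub; have [v _ vu] : range (@inc B U b) u; [rewrite inc_range|exists v].
Qed.

Lemma totmap_inc U V (phi : forall b, U b -> V b) b (v : U b) :
  totmap phi (inc v) = inc (phi b v).
Proof. exact: (inc_congr (fun b v => inc (phi b v)) (inc_fib_pt _)). Qed.

Lemma inc_continuous U b : continuous (@inc B U b).
Proof. by apply/continuousP => A oA; apply/inc_open; exists A. Qed.

Lemma continuous_inc U b (T : topologicalType) (h : T -> U b) :
  continuous (fun t => inc (h t)) -> continuous h.
Proof.
move=> /continuousP ch; apply/continuousP => A /inc_open [O oO <-].
exact: ch.
Qed.

Lemma near_fibre_continuous U (b : B) (T : topologicalType) (f : U b -> T) (u : U b)
    (O : set T) : continuous f -> open O -> O (f u) ->
  exists G : set (tot U), [/\ open G, G (inc u) & forall v, G (inc v) -> O (f v)].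
Proof.
move=> /continuousP cf oO Ofu.
have /inc_open [G oG GE] := cf _ oO.
have GO v : G (inc v) <-> O (f v) by rewrite -[G _]/((inc @^-1` G) v) GE.
exists G; split => // [|v]; first exact/GO.
by move=> /GO.
Qed.

End FibredBasics.

(** * Continuous families of functions on fibres *)

(** Continuity, at the points over [z0], of the function that [k] induces on the
    fibre product of [Z] and [tot U] over [B], expressed by neighbourhoods in
    Z x tot U. *)
Definition family_continuous_at (B Z T : topologicalType) (U : fibred B)
    (beta : Z -> B) (k : forall z, U (beta z) -> T) (z0 : Z) : Prop :=
  forall (u0 : U (beta z0)) (O : set T), open O -> O (k z0 u0) ->
    \forall z \near z0 & u \near inc u0, forall v, inc v = u -> O (k z v).

Section FamilyContinuity.
Variables (B Z : topologicalType) (U : fibred B).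

Lemma family_continuous_at_comp (B' T : topologicalType) (V : fibred B')
    (beta : Z -> B) (delta : Z -> B') (k : forall z, U (beta z) -> V (delta z))
    (l : forall z, V (delta z) -> T) (z0 : Z) :
  family_continuous_at (fun z u => inc (k z u)) z0 ->
  family_continuous_at l z0 ->
  family_continuous_at (fun z u => l z (k z u)) z0.
Proof.
move=> ck cl u0 O oO Ou0.
have [[N H] /= [nN nH] NHO] := cl _ _ oO Ou0.
move: nH; rewrite nbhsE => -[H' [oH' H'u] H'H].
have nNu : \forall z \near z0 & u \near inc u0, N z.
  by exists (N, setT) => //=; [split => //; exact: filterT|move=> p []].
apply: filterS2 nNu (ck _ _ oH' H'u) => -[z u] /= Nz kH v vu.
by apply: (NHO (z, inc (k z v))) => //; split => //=; exact: H'H (kH v vu).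
Qed.

Lemma family_continuous_at_reparam (A T : topologicalType) (beta : A -> B)
    (k : forall a, U (beta a) -> T) (r : Z -> A) (z0 : Z) :
  {for z0, continuous r} -> family_continuous_at k (r z0) ->
  family_continuous_at (beta := fun z => beta (r z)) (fun z => k (r z)) z0.
Proof.
move=> cr ck u0 O oO Ou0.
have [[N H] /= [nN nH] NHO] := ck _ _ oO Ou0.
exists (r @^-1` N, H) => /=; first by split => //; exact: cr.
by move=> [z u] [/= Nz Hu]; exact: (NHO (r z, u)).
Qed.

End FamilyContinuity.

Lemma family_continuous_fibre (Z B T : topologicalType) (U : fibred B) (beta : Z -> B)
   (k : forall z, U (beta z) -> T) (z0 : Z) :
  family_continuous_at k z0 -> continuous (k z0).
Proof.
move=> ck u0 S; rewrite nbhsE => -[O [oO Ou0] OS].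
have [[N H] /= [nN nH] NHO] := ck u0 O oO Ou0.
have nH' : nbhs u0 (@inc _ U (beta z0) @^-1` H) by exact: inc_continuous.
apply: filterS nH' => v Hv; apply: OS.
by apply: (NHO (z0, inc v)) => //; split => //=; exact: nbhs_singleton.
Qed.

(** * Fibrewise compactness *)

Section Tube.
Variables (B : topologicalType) (U : fibred B).

(** The tube lemma for the closed map K -> W with compact fibres: an open G that
    contains the fibre of K over [beta y0] contains the fibres over all points
    near [beta y0], since the projection of the rest of K is closed. *)
Lemma tube_over (W : set B) (K : set (tot U)) (Y : topologicalType) (beta : Y -> B)
    (y0 : Y) (P : Y -> tot U -> Prop) :
  open W -> fibrewise_compact_over W K -> {for y0, continuous beta} -> W (beta y0) ->
  (forall u, K u -> pr U u = beta y0 ->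
     \forall y \near y0 & u' \near u, K u' -> pr U u' = beta y -> P y u') ->
  \forall y \near y0, forall u, K u -> pr U u = beta y -> P y u.
Proof.
move=> oW [KW clK cK] cb Wy0 KP.
have [|G [oG KG near_G]] := compact_tube (P := fun y u => K u -> pr U u = beta y -> P y u)
    (y0 := y0) (cK _ Wy0).
  by move=> u [Ku /= ub]; exact: KP.
have [D clD DE] := clK (~` G) (open_closedC oG).
have nD : \forall y \near y0, (~` D `&` W) (beta y).
  apply: cb; apply: open_nbhs_nbhs; split.
    by apply: openI => //; exact: closed_openC.
  split => // Db.
  have : (D `&` W) (beta y0) by [].
  by rewrite -DE => -[u [nGu Ku] ub]; apply: nGu; apply: KG.
apply: filterS2 near_G nD => y GP [nDy Wy] u Ku uy; apply: GP => //.
apply: contrapT => nGu; apply: nDy.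
suff : (D `&` W) (beta y) by case.
by rewrite -DE; exists u.
Qed.

(** These are the sets K that define the neighbourhoods used in
    [map_over_eval]. *)
Lemma fibrewise_compact_closed (C : set (tot U)) :
  fibrewise_compact U -> closed C -> fibrewise_compact_over setT C.
Proof.
move=> [clU cU] clC; split => //.
  move=> D clD; exists (pr U @` (D `&` C)); last by rewrite setIT.
  by apply: clU; exact: closedI.
move=> b _; rewrite setIC.
exact: (compact_closedI (cU b) clC).
Qed.

Lemma tube (Y : topologicalType) (beta : Y -> B) (y0 : Y)
    (P : forall y, U (beta y) -> Prop) :
  fibrewise_compact U -> {for y0, continuous beta} ->
  (forall u : U (beta y0), \forall y \near y0 & u' \near inc u,
     forall v : U (beta y), inc v = u' -> P y v) ->
  \forall y \near y0, forall v, P y v.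
Proof.
move=> cU cb UP.
have := @tube_over setT setT Y beta y0
  (fun y u => forall v : U (beta y), inc v = u -> P y v)
  openT (fibrewise_compact_closed cU closedT) cb I.
have h u : [set: tot U] u -> pr U u = beta y0 ->
    \forall y \near y0 & u' \near u, [set: tot U] u' -> pr U u' = beta y ->
       forall v : U (beta y), inc v = u' -> P y v.
  move=> _ /inc_onto [v <-]; apply: filterS (UP v) => -[y u'] /= h _ _; exact: h.
move=> /(_ h); apply: filterS => y hy v; apply: (hy (inc v)) => //.
exact: pr_inc.
Qed.

End Tube.

(** [k] is, over Z, a closed map: points u of U with [k z u] near [w0] are near the
    fibre of k over [w0], where [l] takes values in O.  The tube lemma is applied
    over Z x tot V; a point [u0] with [k z0 u0 <> w0] is harmless, because
    disjoint neighbourhoods of [k z0 u0] and [w0] make the premise fail near it. *)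
Lemma family_preimage_near (Z B B' T : topologicalType) (U : fibred B) (V : fibred B')
    (beta : Z -> B) (delta : Z -> B') (k : forall z, U (beta z) -> V (delta z))
    (l : forall z, U (beta z) -> T) (z0 : Z) (w0 : V (delta z0)) (O : set T) :
  fibrewise_compact U -> fibrewise_hausdorff V -> {for z0, continuous beta} ->
  family_continuous_at (fun z u => inc (k z u)) z0 -> family_continuous_at l z0 ->
  open O -> (forall u0, k z0 u0 = w0 -> O (l z0 u0)) ->
  \forall z \near z0 & w \near inc w0, forall u, inc (k z u) = w -> O (l z u).
Proof.
move=> cU hV cb ck cl oO kO.
have := @tube _ U (Z * tot V)%type (fun p => beta p.1) (z0, inc w0 : tot V)
  (fun p u => inc (k p.1 u) = p.2 -> O (l p.1 u)) cU.
apply.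
  by apply: continuous_comp; [exact: cvg_fst|exact: cb].
move=> /= u0; have [ku|ku] := pselect (k z0 u0 = w0).
  have [[N H] /= [nN nH] NHO] := cl u0 O oO (kO _ ku).
  exists (N `*` setT, H) => /=.
    by split => //; exists (N, setT) => //; split => //; exact: filterT.
  move=> [[z w] u] [/= [Nz _] Hu] v vu _; exact: (NHO (z, u)).
have ne : inc (k z0 u0) <> inc w0 by move=> /inc_inj.
have [|S [S' [oS oS' Sk S'w SS']]] := hV _ _ _ ne; first by rewrite !pr_inc.
have [[N H] /= [nN nH] NHO] := ck u0 S oS Sk.
exists (N `*` S', H) => /=.
  split => //; exists (N, S') => //; split => //=.
  by apply: open_nbhs_nbhs.
move=> [[z w] u] [/= [Nz S'w'] Hu] v vu kvw.
have : (S `&` S') w by split => //; rewrite -kvw; exact: (NHO (z, u)).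
by rewrite SS'.
Qed.

(** * Pullbacks *)

Section PullbackCompact.
Variables (A B : topologicalType) (f : A -> B) (U : fibred B).

Definition pullback_snd (p : tot (pullback f U)) : tot U := (set_val p).2.

Lemma pullback_snd_continuous : continuous pullback_snd.
Proof.
move=> p; apply: (@continuous_comp _ _ _ (set_val : pullback_tot f U -> _) snd).
  exact: initial_continuous.
exact: cvg_snd.
Qed.

Lemma near_pullback (a : A) (v : U (f a)) (S : set (tot (pullback f U))) :
  nbhs (@inc _ (pullback f U) a v) S ->
  \forall a' \near a & u \near (inc v : tot U),
    forall v' : U (f a'), inc v' = u -> S (@inc _ (pullback f U) a' v').
Proof.
rewrite nbhsE => -[O [[O' oO' <-] Oav] OS].
have : nbhs (a, inc v : tot U) O' by apply: open_nbhs_nbhs; split.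
case=> -[N H] /= [nN nH] NH; exists (N, H) => // -[a' u] [/= Na Hu] v' vu.
by apply: OS; apply: (NH (a', inc v')); split => //=; rewrite vu.
Qed.

(** Closed maps with compact fibres are stable under base change: closedness is the
    tube lemma along [f], and the fibre over a is the compact space U (f a). *)
Lemma pullback_compact :
  continuous f -> fibrewise_compact U -> fibrewise_compact (pullback f U).
Proof.
move=> cf cU; split.
  move=> C clC; rewrite -openC openE => a nCa; rewrite /interior.
  have := @tube _ U A f a (fun a v => ~ C (@inc _ (pullback f U) a v)) cU (@cf a).
  have h (u : U (f a)) : \forall y \near a & u' \near inc u, forall v : U (f y),
      inc v = u' -> ~ C (@inc _ (pullback f U) y v).
    apply: (@near_pullback a u (~` C)).
    apply: open_nbhs_nbhs; split; first exact: closed_openC.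
    by move=> Cu; apply: nCa; exists (@inc _ (pullback f U) a u); rewrite ?pr_inc.
  move=> /(_ h); apply: filterS => y hy [p Cp py].
  by have [v vp] := inc_onto py; apply: (hy v); rewrite vp.
move=> a.
rewrite -(@inc_range _ (pullback f U) a); apply: continuous_compact.
  by apply: continuous_subspaceT; exact: inc_continuous.
have /compact_near_coveringP cUb := cU.2 (f a).
apply/compact_near_coveringP => J F P FF KP.
have := cUb J F (fun i u => forall v : U (f a), inc v = u -> P i v) FF.
have h u : (pr U @^-1` [set f a]) u -> \forall x' \near u & i \near F,
     forall v : U (f a), inc v = x' -> P i v.
  move=> /inc_onto [v <-].
  have [[N H] /= [nN nH] NH] := KP v Logic.I.
  move: nN; rewrite nbhsE => -[O [/inc_open [O' oO' <-] Ov] ON].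
  exists (O', H) => /=; first by split => //; apply: open_nbhs_nbhs.
  move=> [u' i] [/= Ou' Hi] v' v'u; apply: (NH (v', i)); split => //=.
  by apply: ON; rewrite /= v'u.
by move=> /(_ h); apply: filterS => i hi v _; exact: (hi _ (@pr_inc _ U (f a) v) v).
Qed.

Lemma pullback_hausdorff : fibrewise_hausdorff U -> fibrewise_hausdorff (pullback f U).
Proof.
move=> hU p q pq npq.
have pE := set_valP p; have qE := set_valP q.
have e : pr U (pullback_snd p) = pr U (pullback_snd q).
  by rewrite -[LHS]pE -[RHS]qE; congr f; exact: pq.
have ne : pullback_snd p <> pullback_snd q.
  move=> E; apply: npq; apply: val_inj.
  by apply: injective_projections.
have [O [O' [oO oO' Op O'q OO']]] := hU _ _ e ne.
exists (pullback_snd @^-1` O), (pullback_snd @^-1` O'); split => //.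
- by apply: open_comp oO => x _; exact: pullback_snd_continuous.
- by apply: open_comp oO' => x _; exact: pullback_snd_continuous.
- by rewrite -preimage_setI OO' preimage_set0.
Qed.

End PullbackCompact.

Lemma family_continuous_totmap (A B1 B2 : topologicalType) (f : A -> B1) (g : A -> B2)
    (U : fibred B1) (V : fibred B2) (phi : forall a, U (f a) -> V (g a)) :
  continuous (@totmap A (pullback f U) (pullback g V) phi) ->
  forall a0, family_continuous_at (fun a u => inc (phi a u)) a0.
Proof.
move=> cphi a0 u0 O oO Ou0.
pose S := @totmap A (pullback f U) (pullback g V) phi @^-1`
            (@pullback_snd _ _ g V @^-1` O).
have oS : open S.
  apply: open_comp => [x _|]; first exact: cphi.
  by apply: open_comp oO => x _; exact: pullback_snd_continuous.
have SE a (v : U (f a)) : S (@inc _ (pullback f U) a v) <-> O (inc (phi a v)).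
  have E := @totmap_inc A (pullback f U) (pullback g V) phi a v.
  by rewrite /S /preimage /mkset E.
have : nbhs (@inc _ (pullback f U) a0 u0) S.
  by apply: open_nbhs_nbhs; split => //; apply/SE.
move=> /near_pullback; apply: filterS => -[a u] /= h v vu; exact/SE/h.
Qed.

(** * The fibrewise mapping space *)

Section MapOver.
Variables (B : topologicalType) (U V : fibred B).

Lemma map_over_basic_open (W : set B) (K : set (tot U)) (O : set (tot V)) :
  open W -> fibrewise_compact_over W K -> open O -> O `<=` pr V @^-1` W ->
  open (map_over_basic W K O).
Proof.
move=> oW cK oO OW.
exists [set map_over_basic W K O]; last by rewrite bigcup_set1.
move=> _ ->; apply: (@finI_from1 _ _ _ id); by exists W, K, O.
Qed.

(** The sets W of base points are subbasic: take K and O empty. *)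
Lemma mo_base_continuous : continuous (@mo_base B U V).
Proof.
apply/continuousP => W oW.
have -> : @mo_base B U V @^-1` W = map_over_basic W set0 set0.
  by apply/seteqP; split=> [phi|phi []].
apply: map_over_basic_open => //; last exact: open0.
split => //.
  by move=> C _; exists set0; [exact: closed0|rewrite setI0 image_set0 set0I].
by move=> b _; rewrite set0I; exact: compact0.
Qed.

(** A function into the mapping space is continuous if its adjoint is.  A
    subbasic condition on f(K_b) concerns all points of K_b at once, so the tube
    lemma spreads it from one fibre of K to the nearby ones. *)
Lemma continuous_to_map_over (Z : topologicalType) (h : Z -> map_over U V) :
  continuous (fun z => mo_base (h z)) ->
  (forall z0, family_continuous_at
     (fun z (u : U (mo_base (h z))) => inc (mo_fun u)) z0) ->
  continuous h.
Proof.
move=> cb ch z0 A; rewrite /= nbhsE => -[_ [[D sD <-] [C DC Cz]] DA].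
apply: filterS DA _; apply: (@filterS _ _ _ (h @^-1` C)); first by move=> z ?; exists C.
have [E sE EC] := sD _ DC; rewrite -EC preimage_bigcap.
apply: filter_bigI => S ES; have : map_over_subbase S by apply/set_mem/sE.
move=> [W [K [O [oW cK oO OW SE]]]].
have : S (h z0) by move: Cz; rewrite -EC; apply.
rewrite SE => -[Wz KO].
have nW : \forall z \near z0, W (mo_base (h z)).
  by apply: cb; apply: open_nbhs_nbhs.
have := @tube_over _ _ _ _ Z (fun z => mo_base (h z)) z0
  (fun z u => forall v : U (mo_base (h z)), inc v = u -> O (inc (mo_fun v)))
  oW cK (@cb z0) Wz.
have e u : K u -> pr U u = mo_base (h z0) -> \forall y \near z0 & u' \near u,
       K u' -> pr U u' = mo_base (h y) ->
       forall v : U (mo_base (h y)), inc v = u' -> O (inc (mo_fun v)).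
  move=> Ku /inc_onto [u0 u0E]; rewrite -u0E.
  have Ou0 : O (inc (mo_fun u0)) by apply: KO; rewrite u0E.
  by apply: filterS (ch z0 u0 O oO Ou0) => -[z u'] /= hz _ _; exact: hz.
move=> /(_ e); apply: filterS2 nW => z Wz' hz; split => // u Ku.
by apply: hz Ku _ _ _; rewrite ?pr_inc.
Qed.

(** Evaluation is continuous.  Fibrewise regularity gives the subbasic set: the
    part of the compact fibre where [phi0] leaves O has an open neighbourhood H
    whose complement is a neighbourhood of [u0]; this complement is closed, hence
    fibrewise compact, and [phi0] maps its fibre into O. *)
Lemma map_over_eval : fibrewise_compact U -> fibrewise_hausdorff U ->
  forall phi0 : map_over U V,
    family_continuous_at (fun phi u => inc (@mo_fun _ _ _ phi u)) phi0.
Proof.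
move=> cU hU phi0 u0 O oO Ou0.
have [G [oG Gu0 GO]] : exists G : set (tot U), [/\ open G, G (inc u0)
    & forall v, G (inc v) -> O (inc (@mo_fun _ _ _ phi0 v))].
  apply: (near_fibre_continuous (f := fun v => inc (@mo_fun _ _ _ phi0 v))) => //.
  move=> v; apply: continuous_comp; first exact: mo_continuous.
  exact: inc_continuous.
pose F := (pr U @^-1` [set mo_base phi0]) `&` ~` G.
have cF : compact F.
  by apply: compact_closedI; [exact: cU.2|exact: open_closedC].
have [|H [oH FH nH]] := compact_tube (y0 := inc u0) (P := fun u u' : tot U => u <> u') cF.
  move=> u [/= ub nGu].
  have u0u : inc u0 <> u by move=> E; apply: nGu; rewrite -E.
  have [|S [S' [oS oS' Su0 S'u SS']]] := hU (inc u0) u _ u0u; first by rewrite pr_inc ub.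
  exists (S, S') => /=; first by split; apply: open_nbhs_nbhs.
  move=> [x y] [/= Sx Sy] xy.
  have : (S `&` S') x by split => //; rewrite xy.
  by rewrite SS'.
have clH : closed (~` H) by exact: open_closedC.
have nphi : nbhs phi0 (map_over_basic setT (~` H) O).
  apply: open_nbhs_nbhs; split.
    apply: map_over_basic_open => //; first exact: openT.
    exact: fibrewise_compact_closed.
  split => // v nHv; apply: GO; apply: contrapT => nGv; apply: nHv.
  by apply: FH; split => //=; rewrite pr_inc.
exists (map_over_basic setT (~` H) O, [set u | forall u', H u' -> u <> u']) => //=.
move=> [phi u] [/= [_ phiO] uH] v vu; apply: phiO => Hv.
by apply: (uH (inc v)).
Qed.

End MapOver.

Section MappingTopology.
Variables (X : topologicalType) (P Q : operad).
Variables (RP : realization X P) (RQ : realization X Q) (n : nat).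
Local Notation M := (mapping RP RQ n).

Lemma mapping_over_continuous : continuous (@mapping_over _ _ _ RP RQ n : M -> _).
Proof. exact: initial_continuous. Qed.

Lemma mapping_base_continuous : continuous (fun phi : M => (msrc phi, mtgt phi)).
Proof.
move=> phi; apply: (@continuous_comp _ _ _ (@mapping_over _ _ _ RP RQ n : M -> _)
  (@mo_base _ _ _)).
  exact: mapping_over_continuous.
exact: mo_base_continuous.
Qed.

Lemma msrc_continuous : continuous (fun phi : M => msrc phi).
Proof.
move=> phi; apply: (@continuous_comp _ _ _ (fun phi : M => (msrc phi, mtgt phi)) fst).
  exact: mapping_base_continuous.
exact: cvg_fst.
Qed.

Lemma mtgt_continuous : continuous (fun phi : M => mtgt phi).
Proof.
move=> phi; apply: (@continuous_comp _ _ _ (fun phi : M => (msrc phi, mtgt phi)) snd).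
  exact: mapping_base_continuous.
exact: cvg_snd.
Qed.

(** Evaluation of mappings, freed from the pullbacks to P(n) x Q(n) in the
    definition of their topology. *)
Lemma mfun_family_continuous (phi0 : M) :
  family_continuous_at (fun phi u => inc (mfun_of phi u)) phi0.
Proof.
move=> u0 O oO Ou0.
pose f1 := fun b : (P n * Q n)%type => b.1.
pose f2 := fun b : (P n * Q n)%type => b.2.
have cf1 : continuous f1 by move=> b; exact: cvg_fst.
have := map_over_eval (U := pullback f1 (ro RP n)) (V := pullback f2 (ro RQ n))
  (pullback_compact cf1 (@ro_compact _ _ RP n))
  (pullback_hausdorff (@ro_hausdorff _ _ RP n)) (phi0 := mapping_over phi0)
  (u0 := u0) (O := @pullback_snd _ _ f2 (ro RQ n) @^-1` O).
case.
- by apply: open_comp oO => x _; exact: pullback_snd_continuous.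
- exact: Ou0.
move=> [N H] /= [nN /near_pullback [[S T] /= [nS nT] STH]] NH.
exists ((@mapping_over _ _ _ RP RQ n : M -> _) @^-1` N `&`
         (fun phi : M => (msrc phi, mtgt phi)) @^-1` S, T) => /=.
  split => //; apply: filterI; first exact: mapping_over_continuous.
  exact: mapping_base_continuous.
move=> [phi u] [/= [Nphi Sphi] Tu] v vu.
have := NH (mapping_over phi, @inc _ (pullback f1 (ro RP n)) (msrc phi, mtgt phi) v).
apply => //; split => //=.
exact: (STH ((msrc phi, mtgt phi), u)).
Qed.

Lemma continuous_to_mapping (Z : topologicalType) (h : Z -> M) :
  continuous (fun z => msrc (h z)) -> continuous (fun z => mtgt (h z)) ->
  (forall z0, family_continuous_at
     (fun z (u : ro RP n (msrc (h z))) => inc (mfun u)) z0) ->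
  continuous h.
Proof.
move=> cs ct ch.
have cst : continuous (fun z => (msrc (h z), mtgt (h z))).
  by move=> z; apply: cvg_pair; [exact: cs|exact: ct].
have cmo : continuous (fun z => mapping_over (h z)).
  apply: continuous_to_map_over; first exact: cst.
  move=> z0 u0 O oO Ou0.
  have /near_pullback [[S T] /= [nS nT] STO] : nbhs (inc (mo_fun u0)) O.
    by apply: open_nbhs_nbhs.
  move: nT; rewrite nbhsE => -[T' [oT' T'u] T'T].
  have [[N H] /= [nN nH] NH] := ch z0 u0 T' oT' T'u.
  exists ((fun z => (msrc (h z), mtgt (h z))) @^-1` S `&` N,
     @pullback_snd _ _ _ _ @^-1` H) => /=.
    split; first by apply: filterI => //; exact: cst.
    exact: pullback_snd_continuous.
  move=> [z u] [/= [Sz Nz] Hu] v vu.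
  apply: (STO ((msrc (h z), mtgt (h z)), inc (mfun_of (h z) v))) => //.
  split => //; apply: T'T.
  by apply: (NH (z, pullback_snd u)) => //=; rewrite -vu.
apply/continuousP => _ [A oA <-].
by move: cmo => /continuousP; apply.
Qed.

End MappingTopology.

(** * Realization systems *)

Section Realization.
Variables (X : topologicalType) (O : operad) (R : realization X O).

Lemma oact1 n (x : O n) : oact x 1%g = x. Proof. exact: act_on1. Qed.
Lemma oactM n (x : O n) s t : oact (oact x t) s = oact x (s * t)%g.
Proof. exact: act_onM. Qed.

(** The axioms make the symmetry map of the identity idempotent, but they do not
    assert that it is the identity.  It is, since all of |x| is the image of a
    pasting map [mu] for the composite of the unit with x, and this map is
    carried to itself by the block permutation, which is the identity. *)
Lemma symm1 n (x : O n) (u : ro R n x) : inc (symm 1%g u) = inc u.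
Proof.
have e : \sum_(i < 1) n = n by rewrite big_ord1.
have mu_unit (x' : O 1) (i : 'I_1) : x' = ounit O ->
    inc (@mu _ _ R 1 (fun=> n) n e x' (fun=> x) i u) = inc u.
  by move=> ->; rewrite (ord1 i); exact: mu_unit_l.
have := @mu_symm_outer _ _ R 1 (fun=> n) n 1%g e e (ounit O) (fun=> x) ord0 u.
rewrite (bperm1 (m := fun=> n)) mu_unit ?oact1// => <-.
by apply: (inc_congr (fun b v => inc (@symm _ _ R n 1%g b v))); rewrite mu_unit.
Qed.

(** Unlike [symm s], whose codomain varies with the fibre, this function can be
    composed with the one of the inverse permutation. *)
Definition symm_tot n (s : {perm 'I_n}) (w : tot (ro R n)) : tot (ro R n) :=
  inc (symm s (fib_pt w)).

Lemma symm_tot_inc n s (x : O n) (u : ro R n x) : symm_tot s (inc u) = inc (symm s u).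
Proof. exact: (inc_congr (fun b v => inc (symm s v)) (inc_fib_pt _)). Qed.

Lemma symm_tot_continuous n (s : {perm 'I_n}) : continuous (@symm_tot n s).
Proof.
have := @symm_continuous _ _ R n s; set t := totmap _ => ct.
move=> w; apply: (@continuous_comp _ _ _ t (@pullback_snd _ _ _ _)); first exact: ct.
exact: pullback_snd_continuous.
Qed.

(** The inverse of [symm s] on |x| is [symm s^-1] on |xs|, whose values lie over
    (xs)s^-1 = x; it is defined through the total space to cross this equality. *)
Lemma symm_inv_ex n (s : {perm 'I_n}) (x : O n) :
  exists h : ro R n (oact x s) -> ro R n x,
    [/\ continuous h, cancel (@symm _ _ R n s x) h, cancel h (@symm _ _ R n s x)
      & forall w, inc (h w) = symm_tot s^-1 (inc w)].
Proof.
have hex (w : ro R n (oact x s)) : exists v : ro R n x, inc v = symm_tot s^-1 (inc w).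
  by apply: inc_onto; rewrite symm_tot_inc pr_inc oactM mulVg oact1.
pose h w := sval (cid (hex w)).
have hE w : inc (h w) = symm_tot s^-1 (inc w) by rewrite /h; case: cid.
exists h; split => //.
- apply: continuous_inc; rewrite (funext hE) => w.
  by apply: continuous_comp; [exact: inc_continuous|exact: symm_tot_continuous].
- by move=> u; apply: inc_inj; rewrite hE symm_tot_inc symm_symm mulVg symm1.
- move=> w; apply: inc_inj; rewrite -symm_tot_inc hE !symm_tot_inc.
  by rewrite symm_symm mulgV symm1.
Qed.

Definition symm_inv n (s : {perm 'I_n}) (x : O n) : ro R n (oact x s) -> ro R n x :=
  sval (cid (symm_inv_ex s x)).

Lemma symm_inv_continuous n (s : {perm 'I_n}) (x : O n) :
  continuous (@symm_inv n s x).
Proof. by rewrite /symm_inv; case: cid => h []. Qed.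

Lemma symmK n (s : {perm 'I_n}) (x : O n) : cancel (@symm _ _ R n s x) (@symm_inv n s x).
Proof. by rewrite /symm_inv; case: cid => h []. Qed.

Lemma symm_invK n (s : {perm 'I_n}) (x : O n) : cancel (@symm_inv n s x) (@symm _ _ R n s x).
Proof. by rewrite /symm_inv; case: cid => h []. Qed.

Lemma inc_symm_inv n (s : {perm 'I_n}) (x : O n) w :
  inc (@symm_inv n s x w) = symm_tot s^-1 (inc w).
Proof. by rewrite /symm_inv; case: cid => h []. Qed.

Lemma symm_fibre_continuous n (s : {perm 'I_n}) (x : O n) : continuous (@symm _ _ R n s x).
Proof.
apply: continuous_inc.
have -> : (fun t => inc (@symm _ _ R n s x t)) = symm_tot s \o inc.
  by apply/funext => u /=; rewrite symm_tot_inc.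
move=> u; apply: continuous_comp; [exact: inc_continuous|exact: symm_tot_continuous].
Qed.

Section Pasting.
Variables (n : nat) (m : 'I_n -> nat) (N : nat) (e : \sum_(i < n) m i = N).

Lemma lam_family_continuous (b0 : comp_base O m) :
  family_continuous_at (fun (b : comp_base O m) u => inc (@lam _ _ R n m N e b.1 b.2 u)) b0.
Proof. exact: (family_continuous_totmap (@lam_continuous _ _ R n m N e)). Qed.

Lemma mu_family_continuous i (b0 : comp_base O m) :
  family_continuous_at
    (fun (b : comp_base O m) u => inc (@mu _ _ R n m N e b.1 b.2 i u)) b0.
Proof. exact: (family_continuous_totmap (@mu_continuous _ _ R n m N e i)). Qed.

Lemma lam_fibre_continuous x y : continuous (@lam _ _ R n m N e x y).
Proof. by have [[]] := pasting_pushout R e x y. Qed.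

Lemma mu_fibre_continuous x y i : continuous (@mu _ _ R n m N e x y i).
Proof.
exact/continuous_inc/(family_continuous_fibre (@mu_family_continuous i (x, y))).
Qed.

(** The set-level form of the pushout, on which all comparisons of maps out of a
    pasted space rest. *)
Lemma pasting_cover x y w : (exists u, w = @lam _ _ R n m N e x y u) \/
  (exists i u, w = @mu _ _ R n m N e x y i u).
Proof.
have [[[i u] ->]|] := pushout_cover (pasting_pushout R e x y) w; last by left.
by right; exists i, u.
Qed.

End Pasting.
End Realization.

(** * Composition, action and unit of mappings *)

Section Ops.
Variables (X : topologicalType) (P Q : operad).
Variables (RP : realization X P) (RQ : realization X Q).
Local Notation M := (mapping RP RQ).

(** Mappings over equal operations are equal when their graphs agree in the total
    spaces; the equalities of sources and targets need not be conversions. *)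
Lemma mapping_ext n (phi psi : M n) :
  msrc phi = msrc psi -> mtgt phi = mtgt psi ->
  (forall u, exists v, inc u = inc v /\
     inc (mfun_of phi u) = inc (mfun_of psi v)) ->
  phi = psi.
Proof.
case: phi => a c f cf fi fo; case: psi => a' c' g cg gi go /= aa' cc'.
case: a' / aa' g cg gi go => g; case: c' / cc' g => g cg gi go fg.
have E : f = g.
  by apply/funext => u; have [v [/inc_inj <- /inc_inj]] := fg u.
case: g / E cg gi go {fg} => cg gi go.
congr Mapping; exact: Prop_irrelevance.
Qed.

Section Action.
Variables (n : nat) (phi : M n) (s : {perm 'I_n}).
Let f : ro RP n (oact (msrc phi) s) -> ro RQ n (oact (mtgt phi) s) :=
  @symm _ _ RQ n s (mtgt phi) \o mfun_of phi \o @symm_inv _ _ RP n s (msrc phi).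

Let f_continuous : continuous f.
Proof.
move=> w; apply: continuous_comp; first exact: symm_inv_continuous.
by apply: continuous_comp; [exact: mfun_continuous|exact: symm_fibre_continuous].
Qed.

Let f_bd_in i t : f (bd_in RP (oact (msrc phi) s) i t) = bd_in RQ (oact (mtgt phi) s) i t.
Proof.
have := @symm_bd_in _ _ RP n s (msrc phi) (s i) t; rewrite permK => <-.
have := @symm_bd_in _ _ RQ n s (mtgt phi) (s i) t; rewrite permK => <-.
by rewrite /f /= symmK mfun_bd_in.
Qed.

Let f_bd_out t : f (bd_out RP (oact (msrc phi) s) t) = bd_out RQ (oact (mtgt phi) s) t.
Proof. by rewrite -!symm_bd_out /f /= symmK mfun_bd_out. Qed.

Definition mapping_act : M n := Mapping f_continuous f_bd_in f_bd_out.

Lemma mapping_act_symm u :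
  mfun_of mapping_act (symm s u) = symm s (mfun u).
Proof. by rewrite /= /f /= symmK. Qed.

Lemma mapping_actP : mapping_act_spec phi s mapping_act.
Proof.
exists (@symm_inv _ _ RP n s (msrc phi)); split.
- exact: symmK.
- exact: symm_invK.
- by exists f_continuous, f_bd_in, f_bd_out.
Qed.

End Action.

Section Unit.
Let f_ex : exists f : ro RP 1 (ounit P) -> ro RQ 1 (ounit Q),
  continuous f /\ f \o bd_out RP (ounit P) = bd_out RQ (ounit Q).
Proof.
have [_ [_ [g [cg gK _]]]] := unit_homeo RP.
have [_ [cb _]] := unit_homeo RQ.
exists (bd_out RQ (ounit Q) \o g); split.
  by move=> u; apply: continuous_comp; [exact: cg|exact: cb].
by apply/funext => t /=; rewrite gK.
Qed.

Let f := sval (cid f_ex).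
Let f_continuous : continuous f. Proof. by rewrite /f; case: cid => ? []. Qed.
Let f_comp_bd_out : f \o bd_out RP (ounit P) = bd_out RQ (ounit Q).
Proof. by rewrite /f; case: cid => ? []. Qed.

Let f_bd_out t : f (bd_out RP (ounit P) t) = bd_out RQ (ounit Q) t.
Proof. by rewrite -f_comp_bd_out. Qed.

Let f_bd_in i t : f (bd_in RP (ounit P) i t) = bd_in RQ (ounit Q) i t.
Proof. by rewrite (ord1 i) !(unit_homeo _).1 f_bd_out. Qed.

Definition mapping_unit : M 1 := Mapping f_continuous f_bd_in f_bd_out.

Lemma mapping_unit_bd_out t :
  mfun_of mapping_unit (bd_out RP (ounit P) t) = bd_out RQ (ounit Q) t.
Proof. exact: f_bd_out. Qed.

Lemma mapping_unitP : mapping_unit_spec mapping_unit.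
Proof. by exists f, f_continuous, f_bd_in, f_bd_out. Qed.
End Unit.

Section Comp.
Variables (n : nat) (m : 'I_n -> nat) (N : nat) (e : \sum_(i < n) m i = N).
Variables (phi : M n) (psi : forall i, M (m i)).
Let a := msrc phi.
Let b := fun i => msrc (psi i).
Let c := mtgt phi.
Let d := fun i => mtgt (psi i).

Definition is_pasted (G : ro RP N (ocomp e a b) -> ro RQ N (ocomp e c d)) : Prop :=
  [/\ continuous G,
      G \o @lam _ _ RP n m N e a b
      = @lam _ _ RQ n m N e c d \o mfun_of phi
    & forall i : 'I_n,
      G \o @mu _ _ RP n m N e a b i
      = @mu _ _ RQ n m N e c d i \o mfun_of (psi i)].

(** The glued functions agree on the boundaries because f and the g_i preserve
    them and the pasting square of [RQ] commutes. *)
Let F_ex : exists F, unique is_pasted F.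
Proof.
have [_] := pasting_pushout RP e a b.
pose u_ i v := @mu _ _ RQ n m N e c d i (mfun_of (psi i) v).
pose u (p : coprod (fun i => ro RP (m i) (b i))) := u_ (tag p) (tagged p).
move=> /(_ _ u (@lam _ _ RQ n m N e c d \o mfun_of phi)).
case.
- apply: (@sigT_continuous _ _ _ u_) => i v.
  by apply: continuous_comp; [exact: mfun_continuous|exact: mu_fibre_continuous].
- by move=> v; apply: continuous_comp; [exact: mfun_continuous|exact: lam_fibre_continuous].
- apply/funext => -[i t] /=; rewrite /u /u_ /= mfun_bd_out mfun_bd_in.
  have [[_ _ _ _ comm] _] := pasting_pushout RQ e c d.
  exact: (congr1 (@^~ (existT _ i t)) comm).
move=> F [[cF Fu Fl] FU]; exists F; split.
  split => // i; apply/funext => v.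
  by have /(congr1 (@^~ (existT _ i v))) := Fu.
move=> G [cG Gl Gm]; apply: FU; split => //.
by apply/funext => -[i v] /=; have /(congr1 (@^~ v)) := Gm i.
Qed.

Let F := sval (cid F_ex).
Let F_unique : unique is_pasted F. Proof. by rewrite /F; case: cid. Qed.
Let F_continuous : continuous F. Proof. by have [[]] := F_unique. Qed.
Let F_lam u : F (lam e b u) = lam e d (mfun u).
Proof. by have [[_ /(congr1 (@^~ u))]] := F_unique. Qed.
Let F_mu i u : F (@mu _ _ RP n m N e a b i u) = mu e c (mfun u).
Proof. by have [[_ _ /(_ i)/(congr1 (@^~ u))]] := F_unique. Qed.

Let F_bd_in k t : F (bd_in RP (ocomp e a b) k t) = bd_in RQ (ocomp e c d) k t.
Proof.
have [i [j ->]] := blkP e k.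
by rewrite -mu_bd_in F_mu mfun_bd_in mu_bd_in.
Qed.

Let F_bd_out t : F (bd_out RP (ocomp e a b) t) = bd_out RQ (ocomp e c d) t.
Proof. by rewrite -lam_bd_out F_lam mfun_bd_out lam_bd_out. Qed.

Definition mapping_comp : M N := Mapping F_continuous F_bd_in F_bd_out.

Lemma mapping_comp_lam u : mfun_of mapping_comp (lam e b u) = lam e d (mfun u).
Proof. exact: F_lam. Qed.

Lemma mapping_comp_mu i u :
  mfun_of mapping_comp (@mu _ _ RP n m N e a b i u) = mu e c (mfun u).
Proof. exact: F_mu. Qed.

Lemma mapping_compP : mapping_comp_spec e phi psi mapping_comp.
Proof. by exists F; split; [exact: F_unique|exists F_continuous, F_bd_in, F_bd_out]. Qed.

End Comp.

(** * Axioms of an operad *)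

(** Each point of the fibre over the source of [mapping_act phi s] is [symm s u]
    for a u, and there the mapping is known without inverses. *)
Lemma mapping_act_ext n (phi : M n) s (chi : M n) :
  oact (msrc phi) s = msrc chi -> oact (mtgt phi) s = mtgt chi ->
  (forall u, exists v, inc (symm s u) = inc v /\
     inc (symm s (mfun_of phi u)) = inc (mfun_of chi v)) ->
  mapping_act phi s = chi.
Proof.
move=> es et h; apply: mapping_ext => // u.
have [v [uv fuv]] := h (symm_inv u).
exists v; move: uv fuv; rewrite symm_invK => -> <-; split => //.
Qed.

Lemma mapping_comp_ext n (m : 'I_n -> nat) N (e : \sum_(i < n) m i = N)
    (phi : M n) (psi : forall i, M (m i)) (chi : M N) :
  ocomp e (msrc phi) (fun i => msrc (psi i)) = msrc chi ->
  ocomp e (mtgt phi) (fun i => mtgt (psi i)) = mtgt chi ->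
  (forall u, exists v, inc (lam e (fun i => msrc (psi i)) u) = inc v /\
     inc (lam e (fun i => mtgt (psi i)) (mfun_of phi u)) =
     inc (mfun_of chi v)) ->
  (forall i u, exists v,
     inc (@mu _ _ _ n m N e (msrc phi) (fun i => msrc (psi i)) i u) = inc v /\
     inc (@mu _ _ _ n m N e (mtgt phi) (fun i => mtgt (psi i)) i
            (mfun_of (psi i) u)) =
     inc (mfun_of chi v)) ->
  mapping_comp e phi psi = chi.
Proof.
move=> es et hl hm; apply: mapping_ext => // w.
have [[u ->]|[i [u ->]]] := pasting_cover w.
  by have [v [? ?]] := hl u; exists v; rewrite mapping_comp_lam.
by have [v [? ?]] := hm i u; exists v; rewrite mapping_comp_mu.
Qed.

Lemma mapping_act1 n (phi : M n) : mapping_act phi 1%g = phi.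
Proof.
apply: mapping_act_ext; rewrite ?oact1 // => u.
by exists u; rewrite !symm1.
Qed.

Lemma mapping_actM n (phi : M n) (s t : {perm 'I_n}) :
  mapping_act (mapping_act phi t) s = mapping_act phi (s * t)%g.
Proof.
apply: mapping_act_ext; rewrite ?oactM // => w.
rewrite -(symm_invK w); move: (symm_inv w) => u.
exists (symm (s * t)%g u).
by rewrite !mapping_act_symm !symm_symm.
Qed.

(** In the fibre over the composite of the unit with [psi], the part coming from
    the unit is the outgoing boundary, which every mapping preserves. *)
Lemma mapping_comp1l n (e : \sum_(i < 1) n = n) (psi : M n) :
  mapping_comp e mapping_unit (fun=> psi) = psi.
Proof.
have [_ [_ [g [_ _ gK]]]] := unit_homeo RP.
apply: mapping_comp_ext; [exact: comp_on1l|exact: comp_on1l| |].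
  move=> u; rewrite -(gK u) mapping_unit_bd_out; exists (bd_out RP (msrc psi) (g u)).
  by rewrite mfun_bd_out -!(unit_homeo _).1 !lam_unit_l.
by move=> i u; exists u; rewrite (ord1 i) !mu_unit_l.
Qed.

(** The parts coming from the units are the incoming boundaries, which every
    mapping preserves. *)
Lemma mapping_comp1r n (e : \sum_(i < n) 1 = n) (phi : M n) :
  mapping_comp e phi (fun=> mapping_unit) = phi.
Proof.
have [_ [_ [g [_ _ gK]]]] := unit_homeo RP.
apply: mapping_comp_ext; [exact: comp_on1r|exact: comp_on1r| |].
  by move=> u; exists u; rewrite !lam_unit_r.
move=> i u; rewrite -(gK u) mapping_unit_bd_out; exists (bd_in RP (msrc phi) i (g u)).
by rewrite mfun_bd_in !mu_unit_r.
Qed.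

(** The fibre over a triple composite is covered by [lam] of [lam], by [lam] of [mu]
    and by [mu], and each piece corresponds to one of the three associativity
    axioms. *)
Lemma mapping_compA n (m : 'I_n -> nat) (l : forall i : 'I_n, 'I_(m i) -> nat)
    (L : 'I_n -> nat) N
    (e1 : \sum_(k < \sum_(i < n) m i) l (tagnat.sig1 k) (tagnat.sig2 k) = N)
    (e2 : forall i : 'I_n, \sum_(j < m i) l i j = L i)
    (e3 : \sum_(i < n) L i = N)
    (phi : M n) (psi : forall i, M (m i)) (chi : forall i j, M (l i j)) :
  mapping_comp e1 (mapping_comp erefl phi psi)
    (fun k => chi (tagnat.sig1 k) (tagnat.sig2 k))
  = mapping_comp e3 phi (fun i => mapping_comp (e2 i) (psi i) (chi i)).
Proof.
apply: mapping_comp_ext.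
- exact: (comp_onA (ostr P) e1 e2 e3 (msrc phi) (fun i => msrc (psi i))
            (fun i j => msrc (chi i j))).
- exact: (comp_onA (ostr Q) e1 e2 e3 (mtgt phi) (fun i => mtgt (psi i))
            (fun i j => mtgt (chi i j))).
- move=> w; have [[u ->]|[i [u ->]]] := pasting_cover w.
    eexists; split; first exact: (assoc_lam_lam e1 e2 e3 _ (fun i j => msrc (chi i j))).
    rewrite !mapping_comp_lam.
    exact: (assoc_lam_lam e1 e2 e3 _ (fun i j => mtgt (chi i j))).
  eexists; split; first exact: (assoc_lam_mu e1 e2 e3 _ (fun i j => msrc (chi i j))).
  rewrite !mapping_comp_mu mapping_comp_lam.
  exact: (assoc_lam_mu e1 e2 e3 _ (fun i j => mtgt (chi i j))).
- move=> k u.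
  eexists; split; first exact: (@assoc_mu_mu _ _ _ _ _ _ _ _ e1 e2 e3 _ _
    (fun i j => msrc (chi i j))).
  rewrite !mapping_comp_mu.
  exact: (@assoc_mu_mu _ _ _ _ _ _ _ _ e1 e2 e3 _ _
    (fun i j => mtgt (chi i j))).
Qed.

Lemma mapping_comp_act_inner n (m : 'I_n -> nat) N (e : \sum_(i < n) m i = N)
    (phi : M n) (psi : forall i, M (m i)) (s : forall i, {perm 'I_(m i)}) :
  mapping_comp e phi (fun i => mapping_act (psi i) (s i))
  = mapping_act (mapping_comp e phi psi) (bsum e s).
Proof.
apply: mapping_comp_ext.
- exact: comp_on_act_inner.
- exact: comp_on_act_inner.
- move=> u; eexists; split; first exact/esym/lam_symm_inner.
  by rewrite mapping_act_symm mapping_comp_lam lam_symm_inner.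
- move=> i w; rewrite -(symm_invK w); move: (symm_inv w) => u.
  eexists; split; first exact/esym/mu_symm_inner.
  by rewrite !mapping_act_symm mapping_comp_mu mu_symm_inner.
Qed.

Lemma mapping_comp_act_outer n (m : 'I_n -> nat) N (s : {perm 'I_n})
    (e : \sum_(k < n) m ((s^-1)%g k) = N) (e' : \sum_(i < n) m i = N)
    (phi : M n) (psi : forall i, M (m i)) :
  mapping_act (mapping_comp e phi (fun k => psi ((s^-1)%g k))) (bperm e e')
  = mapping_comp e' (mapping_act phi s) psi.
Proof.
apply: mapping_act_ext.
- exact: (comp_on_act_outer (ostr P) e e' (msrc phi) (fun i => msrc (psi i))).
- exact: (comp_on_act_outer (ostr Q) e e' (mtgt phi) (fun i => mtgt (psi i))).
move=> w; have [[u ->]|[k [u ->]]] := pasting_cover w.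
  eexists; split; first exact: (lam_symm_outer e e' (fun i => msrc (psi i))).
  rewrite !mapping_comp_lam mapping_act_symm.
  exact: (lam_symm_outer e e' (fun i => mtgt (psi i))).
eexists; split; first exact: (@mu_symm_outer _ _ _ _ _ _ _ e e' _ (fun i => msrc (psi i))).
rewrite !mapping_comp_mu.
exact: (@mu_symm_outer _ _ _ _ _ _ _ e e' _ (fun i => mtgt (psi i))).
Qed.

End Ops.

(** * Continuity of the operations *)

Section Cont.
Variables (X : topologicalType) (P Q : operad).
Variables (RP : realization X P) (RQ : realization X Q).
Local Notation M := (mapping RP RQ).

(** The adjoint sends w to s^* (f ((s^-1)^* w)), where both symmetry maps are
    continuous on total spaces. *)
Lemma mapping_act_continuous n (s : {perm 'I_n}) :
  continuous (fun phi : M n => mapping_act phi s).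
Proof.
apply: continuous_to_mapping.
- move=> phi; apply: (@continuous_comp _ _ _ (fun phi : M n => msrc phi)
    (fun x => oact x s)); [exact: msrc_continuous|exact: act_on_continuous].
- move=> phi; apply: (@continuous_comp _ _ _ (fun phi : M n => mtgt phi)
    (fun x => oact x s)); [exact: mtgt_continuous|exact: act_on_continuous].
move=> phi0.
apply: (@family_continuous_at_comp _ _ _ _ _ _ _ _
  (fun phi (w : ro RP n (oact (msrc phi) s)) => symm_inv w)
  (fun phi u => inc (symm s (mfun_of phi u)))).
  move=> w0 O oO Ow0.
  exists (setT, @symm_tot _ _ RP n s^-1 @^-1` O) => /=.
    split; first exact: filterT.
    apply: symm_tot_continuous; apply: open_nbhs_nbhs; split => //.
    by rewrite -inc_symm_inv.
  by move=> [phi w] [/= _ Ow] v vw; rewrite inc_symm_inv vw.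
move=> u0 O oO Ou0.
have := mfun_family_continuous (phi0 := phi0) (u0 := u0)
  (O := @symm_tot _ _ RQ n s @^-1` O).
case=> [||[N H] /= NH NHO].
- by apply: open_comp oO => x _; exact: symm_tot_continuous.
- by rewrite /= symm_tot_inc.
exists (N, H) => // p /NHO + v vp => /(_ v vp).
by rewrite /= symm_tot_inc.
Qed.

Section Comp.
Variables (n : nat) (m : 'I_n -> nat) (N : nat) (e : \sum_(i < n) m i = N).
Local Notation Z := (M n * prod_topology (fun i => M (m i)))%type.

Let src (z : Z) : comp_base P m := (msrc z.1, fun i => msrc (z.2 i)).
Let tgt (z : Z) : comp_base Q m := (mtgt z.1, fun i => mtgt (z.2 i)).

Let snd_i_continuous i : continuous (fun z : Z => z.2 i).
Proof.
move=> z; apply: (@continuous_comp Z (prod_topology (fun i => M (m i))) (M (m i))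
  snd (fun f => f i)).
  exact: cvg_snd.
exact: (@proj_continuous _ (fun i => M (m i)) i).
Qed.

Let msrc_fst_continuous : continuous (fun z : Z => msrc z.1).
Proof.
move=> z; apply: (@continuous_comp _ _ _ fst (fun phi : M n => msrc phi)).
  exact: cvg_fst.
exact: msrc_continuous.
Qed.

Let msrc_snd_continuous i : continuous (fun z : Z => msrc (z.2 i)).
Proof.
move=> z; apply: (@continuous_comp _ _ _ (fun z : Z => z.2 i)
  (fun psi : M (m i) => msrc psi)).
  exact: snd_i_continuous.
exact: msrc_continuous.
Qed.

Let mtgt_fst_continuous : continuous (fun z : Z => mtgt z.1).
Proof.
move=> z; apply: (@continuous_comp _ _ _ fst (fun phi : M n => mtgt phi)).
  exact: cvg_fst.
exact: mtgt_continuous.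
Qed.

Let mtgt_snd_continuous i : continuous (fun z : Z => mtgt (z.2 i)).
Proof.
move=> z; apply: (@continuous_comp _ _ _ (fun z : Z => z.2 i)
  (fun psi : M (m i) => mtgt psi)).
  exact: snd_i_continuous.
exact: mtgt_continuous.
Qed.

Let src_continuous : continuous src.
Proof.
apply: (@continuous_pair Z _ (prod_topology _) (fun z => msrc z.1)
  (fun z i => msrc (z.2 i))); first exact: msrc_fst_continuous.
by apply: continuous_to_prod => i; exact: msrc_snd_continuous.
Qed.

Let tgt_continuous : continuous tgt.
Proof.
apply: (@continuous_pair Z _ (prod_topology _) (fun z => mtgt z.1)
  (fun z i => mtgt (z.2 i))); first exact: mtgt_fst_continuous.
by apply: continuous_to_prod => i; exact: mtgt_snd_continuous.
Qed.

(** By [continuous_to_mapping] it suffices that the composite F is continuous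
    jointly in the mappings and in the point [w0] of the pasted space.  Near [w0],
    points come from [lam] or from some [mu_i], and F is determined there by
    lam (f u) and mu_i (g_i u), which stay in O by [family_preimage_near]. *)
Lemma mapping_comp_continuous : continuous (fun z : Z => mapping_comp e z.1 z.2).
Proof.
apply: continuous_to_mapping.
- move=> z; apply: (@continuous_comp _ _ _ src (fun b => ocomp e b.1 b.2)).
    exact: src_continuous.
  exact: comp_on_continuous.
- move=> z; apply: (@continuous_comp _ _ _ tgt (fun b => ocomp e b.1 b.2)).
    exact: tgt_continuous.
  exact: comp_on_continuous.
move=> z0 w0 O oO Ow0.
have lamO : \forall z \near z0 & w \near inc w0, forall u : ro RP n (msrc z.1),
    inc (@lam _ _ RP n m N e (src z).1 (src z).2 u) = w ->
    O (inc (@lam _ _ RQ n m N e (tgt z).1 (tgt z).2 (mfun u))).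
  apply: (@family_preimage_near Z _ _ _ (ro RP n) (ro RP N) (fun z => msrc z.1)
    (fun z => ocomp e (src z).1 (src z).2)
    (fun z u => @lam _ _ RP n m N e (src z).1 (src z).2 u)
    (fun z u => inc (@lam _ _ RQ n m N e (tgt z).1 (tgt z).2 (mfun u)))) => //.
  - exact: ro_compact.
  - exact: ro_hausdorff.
  - exact: msrc_fst_continuous.
  - exact: (@family_continuous_at_reparam _ Z (ro RP n) (comp_base P m) _ (fun b => b.1)
       (fun b u => inc (@lam _ _ RP n m N e b.1 b.2 u)) src z0 (@src_continuous z0)
       (@lam_family_continuous _ _ _ _ _ _ _ _)).
  - apply: (@family_continuous_at_comp _ _ _ _ _ _ (fun z : Z => msrc z.1)
      (fun z => mtgt z.1) (fun z u => mfun_of z.1 u)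
      (fun z v => inc (@lam _ _ RQ n m N e (tgt z).1 (tgt z).2 v))).
      exact: (@family_continuous_at_reparam _ Z (ro RP n) (M n) _ (fun phi => msrc phi)
        (fun phi u => inc (mfun_of phi u)) fst z0 (@cvg_fst _ _ _ _ _)
        (@mfun_family_continuous _ _ _ _ _ _ _)).
    exact: (@family_continuous_at_reparam _ Z (ro RQ n) (comp_base Q m) _ (fun b => b.1)
       (fun b u => inc (@lam _ _ RQ n m N e b.1 b.2 u)) tgt z0 (@tgt_continuous z0)
       (@lam_family_continuous _ _ _ _ _ _ _ _)).
  - by move=> u u_w; move: Ow0; rewrite -u_w mapping_comp_lam.
have muO i : \forall z \near z0 & w \near inc w0, forall u : ro RP (m i) (msrc (z.2 i)),
    inc (@mu _ _ RP n m N e (src z).1 (src z).2 i u) = w ->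
    O (inc (@mu _ _ RQ n m N e (tgt z).1 (tgt z).2 i (mfun u))).
  apply: (@family_preimage_near Z _ _ _ (ro RP (m i)) (ro RP N) (fun z => msrc (z.2 i))
    (fun z => ocomp e (src z).1 (src z).2)
    (fun z u => @mu _ _ RP n m N e (src z).1 (src z).2 i u)
    (fun z u => inc (@mu _ _ RQ n m N e (tgt z).1 (tgt z).2 i (mfun u)))) => //.
  - exact: ro_compact.
  - exact: ro_hausdorff.
  - exact: msrc_snd_continuous.
  - exact: (@family_continuous_at_reparam _ Z (ro RP (m i)) (comp_base P m) _ (fun b => b.2 i)
       (fun b u => inc (@mu _ _ RP n m N e b.1 b.2 i u)) src z0 (@src_continuous z0)
       (@mu_family_continuous _ _ _ _ _ _ _ _ _)).
  - apply: (@family_continuous_at_comp _ _ _ _ _ _ (fun z : Z => msrc (z.2 i))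
      (fun z => mtgt (z.2 i)) (fun z u => mfun_of (z.2 i) u)
      (fun z v => inc (@mu _ _ RQ n m N e (tgt z).1 (tgt z).2 i v))).
      exact: (@family_continuous_at_reparam _ Z (ro RP (m i)) (M (m i)) _ (fun phi => msrc phi)
        (fun phi u => inc (mfun_of phi u)) (fun z => z.2 i) z0
        (@snd_i_continuous i z0) (@mfun_family_continuous _ _ _ _ _ _ _)).
    exact: (@family_continuous_at_reparam _ Z (ro RQ (m i)) (comp_base Q m) _ (fun b => b.2 i)
       (fun b u => inc (@mu _ _ RQ n m N e b.1 b.2 i u)) tgt z0 (@tgt_continuous z0)
       (@mu_family_continuous _ _ _ _ _ _ _ _ _)).
  - by move=> u u_w; move: Ow0; rewrite -u_w mapping_comp_mu.
apply: filterS2 lamO (filter_forall _ muO) => -[z w] /= {}lamO {}muO v vw.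
have [[u vE]|[i [u vE]]] := pasting_cover v; rewrite vE.
  apply: (eq_ind_r (fun x => O (inc x)) _
    (@mapping_comp_lam _ _ _ RP RQ n m N e z.1 z.2 u)).
  by apply: lamO; rewrite -vw vE.
apply: (eq_ind_r (fun x => O (inc x)) _
  (@mapping_comp_mu _ _ _ RP RQ n m N e z.1 z.2 i u)).
by apply: muO; rewrite -vw vE.
Qed.

End Comp.

Definition mapping_operad_on : operad_on (mapping_space RP RQ) :=
  @OperadOn (mapping_space RP RQ) (fun n phi s => mapping_act phi s) (mapping_unit RP RQ)
    (fun n m N e phi psi => mapping_comp e phi psi)
    mapping_act_continuous mapping_comp_continuous
    (@mapping_act1 _ _ _ RP RQ) (@mapping_actM _ _ _ RP RQ)
    (@mapping_comp1l _ _ _ RP RQ) (@mapping_comp1r _ _ _ RP RQ)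
    (@mapping_compA _ _ _ RP RQ) (@mapping_comp_act_inner _ _ _ RP RQ)
    (@mapping_comp_act_outer _ _ _ RP RQ).

End Cont.

Theorem theorem2p10 (X : topologicalType)
    (X_compact : compact [set: X]) (X_hausdorff : hausdorff_space X)
    (P Q : operad) (RP : realization X P) (RQ : realization X Q) :
  exists S : operad_on (mapping_space RP RQ),
    let M := Operad S in
    [/\ (forall (n : nat) (phi : mapping RP RQ n) (s : {perm 'I_n}),
           mapping_act_spec phi s (@oact M n phi s)),
        mapping_unit_spec (ounit M),
        (forall (n : nat) (m : 'I_n -> nat) (N : nat) (e : \sum_(i < n) m i = N)
           (phi : mapping RP RQ n) (psi : forall i : 'I_n, mapping RP RQ (m i)),
           mapping_comp_spec e phi psi (@ocomp M n m N e phi psi)),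
        @is_operad_morphism M P (fun n phi => msrc (phi : mapping RP RQ n))
      & @is_operad_morphism M Q (fun n phi => mtgt (phi : mapping RP RQ n))].
Proof.
exists (mapping_operad_on RP RQ); split.
- exact: mapping_actP.
- exact: mapping_unitP.
- exact: mapping_compP.
- by split => //; exact: msrc_continuous.
- by split => //; exact: mtgt_continuous.
Qed.
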